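(* Let $a,b\ge 1$ be integers, let $P\colon \Sigma_{a,b}\to\mathbb{RP}^{a+b}$ be an extensive Kœnigs net, and let $\mathcal C$ be an instance of touching conics of $P$. Then there is a unique inscribed quadric $\mathcal Q\subset\mathbb{RP}^{a+b}$ of $P$ with respect to $\mathcal C$.
   Context: Notation: $\Sigma_m=\{0,1,\dots,m\}$, $\Sigma_{a,b}=\Sigma_a\times\Sigma_b$; $\vee$ denotes the join (span) of projective subspaces. Q-nets: a Q-net is a map $P\colon\Sigma_{a,b}\to\mathbb{RP}^n$ such that the four points $P(i,j),P(i+1,j),P(i+1,j+1),P(i,j+1)$ of every face lie in a plane. It is non-degenerate if the points at the two ends of each edge are distinct and any three of the four points of each face span a plane. A Q-net on $\Sigma_{a,b}$ is extensive if it is non-degenerate and the join of its image is $(a+b)$-dimensional. Laplace points of a face: $P_1(i,j)=(P(i,j)\vee P(i,j+1))\cap(P(i+1,j)\vee P(i+1,j+1))$ and $P_{-1}(i,j)=(P(i,j)\vee P(i+1,j))\cap(P(i,j+1)\vee P(i+1,j+1))$. Touching conics: an inscribed conic of a face is a conic in the plane of the face which is either a non-degenerate conic tangent to the four edge-lines of the face, or the double line $P_1(i,j)\vee P_{-1}(i,j)$ (which touches each edge-line in its intersection point with it); no other degenerate conics are admitted. An instance of touching conics $\mathcal C$ assigns to each face, with vertices $P(i,j),P(i+1,j),P(i+1,j+1),P(i,j+1)$, an inscribed conic $\mathcal C(i,j)$ such that for every edge shared by two faces the conics of the two faces touch the edge-line in the same point. A Kœnigs net is a non-degenerate Q-net that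 admits an instance of touching conics. Touching points: $S\colon\Sigma_{a-1,b}\to\mathbb{RP}^{n}$, where $S(i,j)$ is the point in which the conic(s) of the face(s) adjacent to the edge $(i,j),(i+1,j)$ touch the line $P(i,j)\vee P(i+1,j)$; $T\colon\Sigma_{a,b-1}\to\mathbb{RP}^{n}$, where $T(i,j)$ is the point in which the conic(s) of the face(s) adjacent to the edge $(i,j),(i,j+1)$ touch the line $P(i,j)\vee P(i,j+1)$. Write $S^{\mathrm h}(j)$ for the join of all points $S(i,j)$ with $j$ fixed, and $T^{\mathrm v}(i)$ for the join of all points $T(i,j)$ with $i$ fixed. A quadric is the zero set $\{[x]\mid\varphi(x,x)=0\}$ of a non-zero symmetric bilinear form $\varphi$ on $\mathbb R^{n+1}$; a quadric in a plane is a conic; a quadric is non-degenerate if it is non-empty and has no singular point. A quadric $\mathcal Q\subset\mathbb{RP}^{a+b}$ is an inscribed quadric of $P$ with respect to $\mathcal C$ if: (1) $\mathcal Q\cap(P(i,j)\vee P(i+1,j)\vee P(i,j+1))=\mathcal C(i,j)$ for all $(i,j)\in\Sigma_{a-1,b-1}$; (2) $T^{\mathrm v}(i)\subset\mathcal Q$ for all $i\in\Sigma_a$; (3) $S^{\mathrm h}(j)\subset\mathcal Q$ for all $j\in\Sigma_b$. *)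

(* Defs.v *)
From HB Require Import structures.
From mathcomp Require Import all_boot all_order all_algebra.
From mathcomp Require Import boolp classical_sets reals.

Set Implicit Arguments.
Unset Strict Implicit.
Unset Printing Implicit Defensive.

Import GRing.Theory.

Local Open Scope ring_scope.
Local Open Scope classical_set_scope.

(* A projective subspace of RP^n is a linear subspace of R^(n+1): its
   projective dimension is [\dim U - 1], joins are sums [(U + V)%VS], and
   intersections are [(U :&: V)%VS]. *)
Notation psubspace R n := {vspace 'rV[R]_n.+1}.

Record ppoint (R : realType) (n : nat) :=
  PPoint { pspace :> psubspace R n; _ : \dim pspace == 1%N }.

HB.instance Definition _ (R : realType) (n : nat) :=
  [isSub for @pspace R n].
HB.instance Definition _ (R : realType) (n : nat) :=
  [Choice of ppoint R n by <:].

Definition points_of (R : realType) (n : nat) (U : psubspace R n) :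
  set (ppoint R n) := [set p : ppoint R n | (p <= U)%VS].

Section Quadrics.
Variables (R : realType) (n : nat).
Implicit Types (U l : psubspace R n) (Q : set (ppoint R n)).
Implicit Types phi : {symmetric 'rV[R]_n.+1}.

(* [Q] is the quadric of [U] with equation [phi]. A non-zero form on [U] is
   given as a form on the whole space whose restriction to [U] is non-zero. *)
Definition equation U phi Q :=
  (exists u v, [/\ u \in U, v \in U & phi u v != 0]) /\
  Q = [set p : ppoint R n |
        (p <= U)%VS /\ forall x, x \in pspace p -> phi x x = 0].

Definition quadric U Q := exists phi, equation U phi Q.

Definition singular_point U phi Q (p : ppoint R n) :=
  Q p /\ forall x u, x \in pspace p -> u \in U -> phi x u = 0.

Definition nondegenerate_quadric U Q :=
  Q !=set0 /\
  exists2 phi, equation U phi Q & ~ exists p, singular_point U phi Q p.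

(* [l] lies in the polar of the point [p] of [Q], i.e. [l] meets [Q] with
   multiplicity at least two in [p]. At a non-singular point this says that
   [l] is tangent to [Q]; if [Q] is a double line, which is singular in each of
   its points, it says that [p] is an intersection point of [l] and [Q]. *)
Definition touches U Q l (p : ppoint R n) :=
  [/\ Q p, (p <= l)%VS &
      exists2 phi, equation U phi Q &
        forall x y, x \in pspace p -> y \in l -> phi x y = 0].

End Quadrics.

(* The indices [i] and [i + 1] of the two ends of the [i]-th edge. *)
Definition lo (m : nat) (i : 'I_m) : 'I_m.+1 := widen_ord (leqnSn m) i.
Definition hi (m : nat) (i : 'I_m) : 'I_m.+1 := lift ord0 i.

Definition net (R : realType) (n a b : nat) :=
  'I_a.+1 -> 'I_b.+1 -> ppoint R n.

Section Nets.
Variables (R : realType) (n a b : nat) (P : net R n a b).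

Definition qnet := forall (i : 'I_a) (j : 'I_b),
  exists2 E : psubspace R n, \dim E = 3%N &
    [/\ (P (lo i) (lo j) <= E)%VS, (P (hi i) (lo j) <= E)%VS,
        (P (hi i) (hi j) <= E)%VS & (P (lo i) (hi j) <= E)%VS].

Definition spans_plane (p q r : ppoint R n) := \dim (p + q + r)%VS = 3%N.

Definition nondegenerate_qnet :=
  [/\ qnet,
      forall (i : 'I_a) (j : 'I_b.+1), P (lo i) j <> P (hi i) j,
      forall (i : 'I_a.+1) (j : 'I_b), P i (lo j) <> P i (hi j) &
      forall (i : 'I_a) (j : 'I_b),
        [/\ spans_plane (P (lo i) (lo j)) (P (hi i) (lo j)) (P (hi i) (hi j)),
            spans_plane (P (hi i) (lo j)) (P (hi i) (hi j)) (P (lo i) (hi j)),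
            spans_plane (P (hi i) (hi j)) (P (lo i) (hi j)) (P (lo i) (lo j)) &
            spans_plane (P (lo i) (hi j)) (P (lo i) (lo j)) (P (hi i) (lo j))]].

Definition extensive :=
  nondegenerate_qnet /\
  \dim (\sum_(i < a.+1) \sum_(j < b.+1) pspace (P i j))%VS = (a + b).+1%N.

Definition hedge_line (i : 'I_a) (j : 'I_b.+1) : psubspace R n :=
  (P (lo i) j + P (hi i) j)%VS.
Definition vedge_line (i : 'I_a.+1) (j : 'I_b) : psubspace R n :=
  (P i (lo j) + P i (hi j))%VS.

Definition face_plane (i : 'I_a) (j : 'I_b) : psubspace R n :=
  (P (lo i) (lo j) + P (hi i) (lo j) + P (lo i) (hi j))%VS.

(* The Laplace points P_1(i,j) and P_{-1}(i,j), which are points if the net is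
   non-degenerate. *)
Definition laplace1 (i : 'I_a) (j : 'I_b) : psubspace R n :=
  (vedge_line (lo i) j :&: vedge_line (hi i) j)%VS.
Definition laplaceN1 (i : 'I_a) (j : 'I_b) : psubspace R n :=
  (hedge_line i (lo j) :&: hedge_line i (hi j))%VS.

Definition inscribed_conic (i : 'I_a) (j : 'I_b) (c : set (ppoint R n)) :=
  quadric (face_plane i j) c /\
  ((nondegenerate_quadric (face_plane i j) c /\
    [/\ exists p, touches (face_plane i j) c (hedge_line i (lo j)) p,
        exists p, touches (face_plane i j) c (hedge_line i (hi j)) p,
        exists p, touches (face_plane i j) c (vedge_line (lo i) j) p &
        exists p, touches (face_plane i j) c (vedge_line (hi i) j) p]) \/
   c = points_of (laplace1 i j + laplaceN1 i j)%VS).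

Variable C : 'I_a -> 'I_b -> set (ppoint R n).

(* [p] is the point in which the conics of all faces (one or two) adjacent to
   the edge touch its line. *)
Definition htouching (i : 'I_a) (j : 'I_b.+1) (p : ppoint R n) :=
  forall k : 'I_b, j = lo k \/ j = hi k ->
    touches (face_plane i k) (C i k) (hedge_line i j) p.
Definition vtouching (i : 'I_a.+1) (j : 'I_b) (p : ppoint R n) :=
  forall k : 'I_a, i = lo k \/ i = hi k ->
    touches (face_plane k j) (C k j) (vedge_line i j) p.

Definition touching_conics :=
  [/\ forall i j, inscribed_conic i j (C i j),
      forall (i : 'I_a) (j k : 'I_b), hi j = lo k ->
        exists p, touches (face_plane i j) (C i j) (hedge_line i (hi j)) p /\
                  touches (face_plane i k) (C i k) (hedge_line i (lo k)) p &
      forall (i k : 'I_a) (j : 'I_b), hi i = lo k ->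
        exists p, touches (face_plane i j) (C i j) (vedge_line (hi i) j) p /\
                  touches (face_plane k j) (C k j) (vedge_line (lo k) j) p].

(* The touching points S(i,j) and T(i,j). The default values are irrelevant
   for an instance of touching conics with [a], [b] positive: then each edge
   has exactly one touching point. *)
Definition hpoint (i : 'I_a) (j : 'I_b.+1) : ppoint R n :=
  xget (P (lo i) j) [set p | htouching i j p].
Definition vpoint (i : 'I_a.+1) (j : 'I_b) : ppoint R n :=
  xget (P i (lo j)) [set p | vtouching i j p].

Definition hjoin (j : 'I_b.+1) : psubspace R n :=
  (\sum_(i < a) pspace (hpoint i j))%VS.
Definition vjoin (i : 'I_a.+1) : psubspace R n :=
  (\sum_(j < b) pspace (vpoint i j))%VS.

Definition inscribed_quadric (Q : set (ppoint R n)) :=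
  [/\ quadric fullv Q,
      forall i j, Q `&` points_of (face_plane i j) = C i j,
      forall i, points_of (vjoin i) `<=` Q &
      forall j, points_of (hjoin j) `<=` Q].

End Nets.

Definition koenigs_net (R : realType) (n a b : nat) (P : net R n a b) :=
  nondegenerate_qnet P /\
  exists C : 'I_a -> 'I_b -> set (ppoint R n), touching_conics P C.

(* Main.v *)
(** Kœnigs nets are Moutard nets: normalising the equation of the conic of a
    face to be 1 on suitable homogeneous coordinates [u] of its vertices, the
    conic touches each edge in the difference of its ends, and
    u00 + u11 = mu (u10 + u01). The normalisations of neighbouring faces agree
    because the conics touch a common edge in the same point, so the whole net
    has such a lift [y]. The quadric is inscribed if and only if its form is, up
    to a scalar, 1 on any two points of [y] in the same row or column: this
    makes the joins of touching points isotropic, and with the Moutard equation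
    it prescribes the form on each face. Along a strip of faces between
    neighbouring columns [y], [z] such a form satisfies
    phi(z_(k+1), y_l) + 1 = mu_k (phi(z_k, y_l) + 1),
    which determines it from the columns to the left, and shows that the
    condition on one column or row passes on to the next. *)

From HB Require Import structures.
Require Import Defs.
From mathcomp Require Import all_boot all_order all_algebra.
From mathcomp Require Import boolp classical_sets reals.
From mathcomp Require Import ring lra zify.

Set Implicit Arguments.
Unset Strict Implicit.
Unset Printing Implicit Defensive.

Import Order.TTheory GRing.Theory Num.Theory.

(** The conditions on the form far outnumber its free values. A column together with row 0 consists
    of [a + b + 1] points and generates the net through the Moutard equation; extensivity makes this
    hook a basis. Passing to the next column therefore adds a single vector, its point in row 0. The
    values of the form on this vector are free, and choosing them so that its square and all pairs
    of neighbours joining the two columns get 1 already gives 1 on all pairs of the new column.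
    Conics are given as sets, so equations must be recovered from zero sets: over the reals a
    non-empty non-degenerate conic and a double line both determine their form up to a factor.
    Scaling three vertices of a face normalises only three of its edges; the fourth is normalised up
    to a sign, which has to be excluded. *)

Section SymmetricForms.
Local Open Scope ring_scope.
Variables (F : comNzRingType) (V : lmodType F).
Implicit Types (phi : {symmetric V}) (u v w : V).

Lemma sformC phi u v : phi u v = phi v u.
Proof. by rewrite hermC expr0 mul1r. Qed.

Lemma sformDl phi u v w : phi (u + v) w = phi u w + phi v w.
Proof. exact: linearDl. Qed.

Lemma sformDr phi u v w : phi w (u + v) = phi w u + phi w v.
Proof. exact: linearDr. Qed.

Lemma sformZl phi k u w : phi (k *: u) w = k * phi u w.
Proof. exact: linearZl_LR. Qed.

Lemma sformZr phi k u w : phi w (k *: u) = k * phi w u.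
Proof. exact: linearZr_LR. Qed.

Lemma sformNl phi u w : phi (- u) w = - phi u w.
Proof. exact: linearNl. Qed.

Lemma sformNr phi u w : phi w (- u) = - phi w u.
Proof. exact: linearNr. Qed.

Lemma sform0l phi w : phi 0 w = 0.
Proof. exact: linear0l. Qed.

Lemma sform0r phi w : phi w 0 = 0.
Proof. exact: linear0r. Qed.

Definition sformE := (sformDl, sformDr, sformNl, sformNr, sformZl, sformZr).

Lemma symmetric_formP (f : V -> V -> F) :
    (forall u v, f u v = f v u) ->
    (forall k u v w, f (k *: u + v) w = k * f u w + f v w) ->
  exists phi : {symmetric V}, forall u v, phi u v = f u v.
Proof.
move=> fC fP.
have f0 w : f 0 w = 0 by have := fP 1 0 0 w; rewrite scale1r addr0 mul1r => /eqP;
  rewrite -subr_eq0 opprD addNKr oppr_eq0 => /eqP.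
have zl w : zmod_morphism (f ^~ w).
  by move=> u v; rewrite addrC -scaleN1r fP mulN1r addrC.
have zr w : zmod_morphism (f w) by move=> u v; rewrite !(fC w) zl.
have sl w : scalable_for *%R (f ^~ w).
  by move=> k u; rewrite -[k *: u]addr0 fP f0 addr0.
have sr w : scalable_for (idfun \; *%R) (f w).
  by move=> k u; rewrite /= !(fC w) sl.
pose B := isBilinear.Build F V V F *%R (idfun \; *%R) f zl zr sl sr.
have fH u v : f u v = (-1) ^+ false * idfun (f v u) by rewrite expr0 mul1r fC.
pose H := isHermitianSesquilinear.Build F V false idfun f fH.
pose phi : {symmetric V} := HB.pack f B H.
by exists phi.
Qed.

End SymmetricForms.

(** * Moutard nets *)

Section LinearPredicates.
Local Open Scope ring_scope.
Variables (F : fieldType) (V : vectType F).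
Implicit Types (W : V -> Prop) (u v w : V).

(** Subspaces as predicates: vanishing of a functional or agreement of two forms in one argument can
    be carried through the net without building a [vspace]. *)
Definition linear_pred W := W 0 /\ forall k u v, W u -> W v -> W (k *: u + v).

Definition linear_functional (f : V -> F) :=
  forall k u v, f (k *: u + v) = k * f u + f v.

Lemma linear_predZ W k u : linear_pred W -> W u -> W (k *: u).
Proof. by move=> [W0 WL] Wu; rewrite -[k *: u]addr0; apply: WL. Qed.

Lemma linear_predD W u v : linear_pred W -> W u -> W v -> W (u + v).
Proof. by move=> [W0 WL] Wu Wv; rewrite -[u]scale1r; apply: WL. Qed.

Lemma linear_predB W u v : linear_pred W -> W u -> W v -> W (u - v).
Proof.
by move=> WL Wu Wv; rewrite -scaleN1r addrC; apply: WL.2.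
Qed.

Lemma linear_pred_span W (I : finType) (U : I -> {vspace V}) :
    linear_pred W -> (forall i u, u \in U i -> W u) ->
  forall v, v \in (\sum_i U i)%VS -> W v.
Proof.
move=> WL WU v /memv_sumP[w wU ->].
elim/big_ind: _ => [|u u' Wu Wu'|i _]; first exact: WL.1.
  exact: linear_predD.
by apply: (WU i); apply: wU.
Qed.

(** Generators equal in number to the dimension form a basis; [f] combines its coordinates with
    coefficients [c]. *)
Lemma functional_interpolation m (e : 'I_m -> V) (c : 'I_m -> F) :
    \dim {:V} = m ->
    (forall W, linear_pred W -> (forall k, W (e k)) -> forall v, W v) ->
  exists2 f, linear_functional f & forall k, f (e k) = c k.
Proof.
move=> dimV spanV; pose B := [tuple e k | k < m].
have sB : <<B>>%VS = fullv.
  apply/vspaceP=> v; rewrite memvf.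
  apply: (spanV (fun v => v \in <<B>>%VS)) => [|k].
    by split=> [|k u w uB wB]; rewrite ?mem0v // memvD // memvZ.
  by apply: memv_span; apply/tnthP; exists k; rewrite tnth_mktuple.
have bB : basis_of fullv B.
  by rewrite basisEdim sB subvv size_tuple dimV leqnn.
exists (fun v => \sum_k c k * coord B k v) => [k u v|k].
  rewrite mulr_sumr -big_split; apply: eq_bigr => l _ /=.
  by rewrite linearD linearZ /=; ring.
have -> : e k = B`_k by rewrite -tnth_nth tnth_mktuple.
rewrite (bigD1 k) //= coord_free ?(basis_free bB) // eqxx mulr1.
rewrite big1 ?addr0 // => l /negPf lk.
by rewrite coord_free ?(basis_free bB) // eq_sym lk mulr0.
Qed.

End LinearPredicates.

Section MoutardNets.
Local Open Scope ring_scope.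
Variables (F : realFieldType) (V : vectType F).

Section Strip.
Variables (m : nat) (y z : nat -> V) (mu : nat -> F) (phi : {symmetric V}).
Hypothesis mu0 : forall k, (k < m)%N -> mu k != 0.
Hypothesis moutard : forall k, (k < m)%N ->
  y k + z k.+1 = mu k *: (z k + y k.+1).
Hypothesis yy : forall k l, (k <= m)%N -> (l <= m)%N -> phi (y k) (y l) = 1.

Let zS k : (k < m)%N -> z k.+1 = mu k *: (z k + y k.+1) - y k.
Proof. by move=> km; rewrite -moutard // addrC addKr. Qed.

Lemma strip_rungS k l : (k < m)%N -> (l <= m)%N ->
  phi (z k.+1) (y l) + 1 = mu k * (phi (z k) (y l) + 1).
Proof.
by move=> km lm; rewrite zS // !sformE !yy //; ring || exact: ltnW.
Qed.

(** The relation [Q k l] is the counterpart of [strip_rungS] with the two columns exchanged. For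
    fixed [k] both of its sides are multiplied by [mu l] when [l] grows by one, so it holds for all
    [l] once it holds at [l = k], where the rungs give it. It then lets the Moutard equation carry
    the value 1 along [z], starting from the square of [z 0]. *)
Lemma strip_const : (forall k, (k <= m)%N -> phi (z k) (y k) = 1) ->
    phi (z 0) (z 0) = 1 ->
  forall k l, (k <= m)%N -> (l <= m)%N -> phi (z k) (z l) = 1.
Proof.
move=> zy z00.
pose Q k l := phi (z l) (y k) + 1 = mu k * (phi (z l) (y k.+1) + 1).
have QS k l : (k < m)%N -> (l < m)%N -> Q k l <-> Q k l.+1.
  move=> km lm; rewrite /Q !strip_rungS //; last exact: ltnW.
  split=> [->|]; first by ring.
  by rewrite mulrCA => /(mulfI (mu0 lm)).
have Q0 k l : (k < m)%N -> (l <= m)%N -> Q k l <-> Q k 0%N.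
  move=> km; elim: l => [//|l IH] lm.
  have [QS1 QS2] := QS k l km lm; have [Q1 Q2] := IH (ltnW lm).
  by split=> [/QS2/Q1|/Q2/QS1].
have Qkk k : (k < m)%N -> Q k k.
  by move=> km; rewrite /Q -strip_rungS // !zy // ltnW.
have QQ k l : (k < m)%N -> (l <= m)%N -> Q k l.
  by move=> km lm; apply/Q0 => //; apply/(Q0 k k) => //; [apply: ltnW|apply: Qkk].
have step l : (l <= m)%N -> phi (z 0) (z l) = 1 ->
    forall k, (k <= m)%N -> phi (z k) (z l) = 1.
  move=> lm zl0; elim=> [//|k IH] km.
  have := QQ k l km lm; rewrite /Q => Qkl.
  rewrite zS // !sformE IH; last exact: ltnW.
  rewrite !(sformC phi _ (z l)) addrC [1 + _]addrC -Qkl; ring.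
move=> k l km lm; apply: (step l lm _ k km).
by rewrite sformC; apply: (step 0%N).
Qed.

End Strip.

Variables (a b : nat) (y : nat -> nat -> V) (mu : nat -> nat -> F).
Hypothesis mu0 : forall i j, (i < a)%N -> (j < b)%N -> mu i j != 0.
Hypothesis moutard : forall i j, (i < a)%N -> (j < b)%N ->
  y i j + y i.+1 j.+1 = mu i j *: (y i.+1 j + y i j.+1).

(** Given a column and the point of row 0 in the column before it, the Moutard equation, divided by
    [mu], yields that earlier column upwards. *)
Lemma moutard_left (W : V -> Prop) i : linear_pred W -> (i <= a)%N ->
    (forall l, (l <= b)%N -> W (y i l)) ->
    (forall k, (k <= i)%N -> W (y k 0)) ->
  forall k l, (k <= i)%N -> (l <= b)%N -> W (y k l).
Proof.
move=> WL; elim: i => [|i IH] ia Wcol Wrow.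
  by move=> k l; rewrite leqn0 => /eqP->; apply: Wcol.
have Wi l : (l <= b)%N -> W (y i l).
  elim: l => [|l IHl] lb; first exact/Wrow/leqnSn.
  have -> : y i l.+1 = (mu i l)^-1 *: (y i l + y i.+1 l.+1) - y i.+1 l.
    by rewrite moutard // scalerA mulVf ?mu0 // scale1r addrC addKr.
  apply: linear_predB => //; last exact/Wcol/ltnW.
  apply: linear_predZ => //; apply: linear_predD => //; last exact: Wcol.
  exact/IHl/ltnW.
move=> k l; rewrite leq_eqVlt => /orP[/eqP->|]; first exact: Wcol.
by apply: IH => //; [apply: ltnW|move=> k' k'i; apply: Wrow; apply: leqW].
Qed.

Lemma moutard_right (W : V -> Prop) i : linear_pred W ->
    (forall l, (l <= b)%N -> W (y i l)) ->
    (forall k, (i <= k)%N -> (k <= a)%N -> W (y k 0)) ->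
  forall k l, (i <= k)%N -> (k <= a)%N -> (l <= b)%N -> W (y k l).
Proof.
move=> WL Wcol Wrow k l ik; rewrite -(subnKC ik).
elim: (k - i)%N l => [|d IH] l; first by rewrite addn0 => _; apply: Wcol.
rewrite addnS => da; elim: l => [|l IHl] lb.
  by apply: Wrow => //; rewrite -addnS leq_addr.
have -> : y (i + d).+1 l.+1 =
    mu (i + d) l *: (y (i + d).+1 l + y (i + d) l.+1) - y (i + d) l.
  by rewrite -moutard // addrC addKr.
apply: linear_predB => //; last by apply: IH => //; apply: ltnW.
apply: linear_predZ => //; apply: linear_predD => //; first exact/IHl/ltnW.
by apply: IH => //; apply: ltnW.
Qed.

Hypothesis dimV : \dim {:V} = (a + b).+1.
Hypothesis spanV : forall W : V -> Prop, linear_pred W ->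
  (forall i j, (i <= a)%N -> (j <= b)%N -> W (y i j)) -> forall v, W v.

Lemma hook_span (W : V -> Prop) i : linear_pred W -> (i <= a)%N ->
    (forall l, (l <= b)%N -> W (y i l)) ->
    (forall k, (k <= a)%N -> W (y k 0)) ->
  forall v, W v.
Proof.
move=> WL ia Wcol Wrow; apply: spanV => // k l ka lb.
case: (leqP k i) => [ki|/ltnW ik]; last first.
  by apply: (@moutard_right W i) => // k' _; apply: Wrow.
by apply: (@moutard_left W i) => // k' k'i; apply: Wrow; apply: leq_trans ia.
Qed.

Lemma hook_interpolation i (c : nat -> nat -> F) : (i <= a)%N ->
  exists f, [/\ linear_functional f,
    forall l, (l <= b)%N -> f (y i l) = c i l &
    forall k, (k <= a)%N -> f (y k 0) = c k 0].
Proof.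
move=> ia.
(* [path] runs along row 0 to the corner [(i, 0)], up column [i], and then along the rest of row 0,
   so that the corner is listed only once. *)
pose path k := if (k < i)%N then (k, 0%N)
  else if (k <= i + b)%N then (i, (k - i)%N) else ((k - b)%N, 0%N).
have pcol l : (l <= b)%N -> path (i + l)%N = (i, l).
  by move=> lb; rewrite /path ltnNge leq_addr leq_add2l lb addKn.
have prow k : (k <= a)%N ->
    exists2 k', (k' < (a + b).+1)%N & path k' = (k, 0%N).
  move=> ka; case: (ltngtP k i) => ki.
  - by exists k; [lia|rewrite /path ki].
  - exists (k + b)%N; first by lia.
    rewrite /path ifF; last by lia.
    by rewrite ifF; [rewrite addnK|lia].
  - by exists (i + 0)%N; [lia|rewrite pcol // ki].
pose e (k : 'I_(a + b).+1) := y (path k).1 (path k).2.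
have [] := @functional_interpolation _ _ _ e
  (fun k => c (path k).1 (path k).2) dimV.
  move=> W WL We; apply: (@hook_span W i) => // [l lb|k ka].
    have il : (i + l < (a + b).+1)%N by lia.
    by have := We (Ordinal il); rewrite /e /= pcol.
  by have [k' k'ab pk] := prow k ka; have := We (Ordinal k'ab); rewrite /e /= pk.
move=> f fL fe; exists f; split=> // [l lb|k ka].
  have il : (i + l < (a + b).+1)%N by lia.
  by have := fe (Ordinal il); rewrite /e /= pcol.
by have [k' k'ab pk] := prow k ka; have := fe (Ordinal k'ab); rewrite /e /= pk.
Qed.

(** If [g] vanishes on a subspace and is 1 at a vector outside it, this update keeps [phi] on the
    subspace and changes its values between the two by [f]. *)
Lemma functional_form (phi : {symmetric V}) f g :
    linear_functional f -> linear_functional g ->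
  exists psi : {symmetric V},
    forall u v, psi u v = phi u v + f u * g v + g u * f v.
Proof.
move=> fL gL; apply: symmetric_formP => [u v|k u v w].
  by rewrite (sformC phi); ring.
by rewrite !sformE fL gL; ring.
Qed.

Definition const_columns (phi : {symmetric V}) i := forall k l l',
  (k <= i)%N -> (l <= b)%N -> (l' <= b)%N -> phi (y k l) (y k l') = 1.

Definition const_row (phi : {symmetric V}) i j := forall k k',
  (k <= i)%N -> (k' <= i)%N -> phi (y k j) (y k' j) = 1.

Definition const_rungs (phi : {symmetric V}) i := forall k l,
  (k < i)%N -> (l <= b)%N -> phi (y k.+1 l) (y k l) = 1.

Lemma moutard_form_columns i : (i <= a)%N -> exists phi : {symmetric V},
  [/\ const_columns phi i, const_row phi i 0 & const_rungs phi i].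
Proof.
elim: i => [|i IH] ia.
  have [f [fL f1 _]] := @hook_interpolation 0 (fun _ _ => 1) (leq0n a).
  have [||phi phiE] := @symmetric_formP F V (fun u v => f u * f v).
  - by move=> u v; rewrite mulrC.
  - by move=> k u v w; rewrite fL; ring.
  exists phi; split=> [k l l'|k k'|//]; rewrite phiE !leqn0.
    by move=> /eqP-> lb l'b; rewrite !f1 // mulr1.
  by move=> /eqP-> /eqP->; rewrite !f1 // mulr1.
have {IH} [phi [colP rowP rungP]] := IH (ltnW ia).
(* The factors of [strip_rungS] multiply up to [x l]; a value 1 on the pair [y i.+1 l], [y i l] thus
   forces the value [2 / x l - 1] on [y i.+1 0], [y i l]. *)
pose x l := \prod_(k < l) mu i k.
have x0 l : (l <= b)%N -> x l != 0.
  move=> lb; apply/prodf_neq0 => k _; apply: mu0 => //.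
  exact: leq_trans (ltn_ord k) lb.
have [g [gL gcol grow]] :=
  @hook_interpolation i (fun k _ => (k == i.+1)%:R) (ltnW ia).
(* Wanted value minus old value, halved at [(i + 1, 0)], where both products of [f] and [g]
   contribute. At the corner [(i, 0)] the column value [2 / x 0 - 1] is 1, as row 0 demands. *)
pose c k l := if k == i.+1 then (1 - phi (y k 0) (y k 0)) / 2 else
  if k == i then 2 / x l - 1 - phi (y i.+1 0) (y k l)
  else 1 - phi (y i.+1 0) (y k l).
have [f [fL fcol frow]] := @hook_interpolation i c (ltnW ia).
(* [g] vanishes on the columns up to [i], so [psi] extends [phi]; the values of
   [f] on column [i] are those forced by [strip_rungS]. *)
have [psi psiE] := functional_form phi fL gL.
have gl0 : linear_pred (fun v => g v = 0).
  split=> [|k u v gu gv]; last by rewrite gL gu gv mulr0 addr0.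
  have := gL 1 0 0; rewrite scale1r addr0 mul1r => /eqP.
  by rewrite -subr_eq0 opprD addNKr oppr_eq0 => /eqP.
have g0 k l : (k <= i)%N -> (l <= b)%N -> g (y k l) = 0.
  apply: (moutard_left gl0 (ltnW ia)) => [l' l'b|k' k'i].
    by rewrite gcol // ltn_eqF.
  by rewrite grow ?ltn_eqF // (leq_trans k'i) // ltnW.
have g1 : g (y i.+1 0) = 1 by rewrite grow // eqxx.
have psiold k l k' l' : (k <= i)%N -> (l <= b)%N -> (k' <= i)%N ->
    (l' <= b)%N -> psi (y k l) (y k' l') = phi (y k l) (y k' l').
  by move=> ki lb k'i l'b; rewrite psiE !g0 // mulr0 mul0r !addr0.
have psinew k l : (k <= i)%N -> (l <= b)%N ->
    psi (y i.+1 0) (y k l) = phi (y i.+1 0) (y k l) + f (y k l).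
  by move=> ki lb; rewrite psiE g1 g0 // mulr0 addr0 mul1r.
have psicol l : (l <= b)%N -> psi (y i.+1 0) (y i l) = 2 / x l - 1.
  move=> lb; rewrite psinew // fcol // /c eqxx ltn_eqF //; ring.
have psirow k : (k <= i)%N -> psi (y i.+1 0) (y k 0) = 1.
  rewrite leq_eqVlt => /orP[/eqP->|ki].
    by rewrite psicol // /x big_ord0; field.
  rewrite psinew ?(ltnW ki) // frow; last exact: leq_trans (ltnW ki) (ltnW ia).
  by rewrite /c (ltn_eqF ki) ltn_eqF 1?ltnW //; ring.
have psiz : psi (y i.+1 0) (y i.+1 0) = 1.
  by rewrite psiE g1 frow // /c eqxx; field.
have mouti k : (k < b)%N ->
    y i k + y i.+1 k.+1 = mu i k *: (y i.+1 k + y i k.+1).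
  by move=> kb; apply: moutard.
have yy k l : (k <= b)%N -> (l <= b)%N -> psi (y i k) (y i l) = 1.
  by move=> kb lb; rewrite psiold // colP.
have rung k l : (k <= b)%N -> (l <= b)%N ->
    psi (y i.+1 k) (y i l) + 1 = x k * (psi (y i.+1 0) (y i l) + 1).
  move=> + lb; elim: k => [|k IHk] kb; first by rewrite /x big_ord0 mul1r.
  rewrite (strip_rungS mouti yy kb lb) (IHk (ltnW kb)).
  by rewrite /x big_ord_recr /=; ring.
have zy k : (k <= b)%N -> psi (y i.+1 k) (y i k) = 1.
  move=> kb; have := rung k k kb kb; rewrite psicol // subrK.
  rewrite mulrCA divff ?x0 // mulr1 => h; apply: (addIr 1); rewrite h; ring.
exists psi; split.
- move=> k l l'; rewrite leq_eqVlt => /orP[/eqP->|ki] lb l'b.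
    by apply: (strip_const _ mouti yy zy psiz) => // k' k'b; apply: mu0.
  by rewrite psiold // colP.
- move=> k k'; rewrite leq_eqVlt => /orP[/eqP->|ki];
    rewrite leq_eqVlt => /orP[/eqP->|k'i] //.
  + exact: psirow.
  + by rewrite (sformC psi) psirow.
  + by rewrite psiold // rowP.
- move=> k l; rewrite ltnS leq_eqVlt => /orP[/eqP->|ki] lb; first exact: zy.
  by rewrite psiold ?rungP // ltnW.
Qed.

(** The strip between neighbouring rows obeys the same Moutard equation with the indices exchanged.
    Its rungs are pairs in a column, where the value is already 1, so the rows follow upwards from
    row 0. *)
Lemma moutard_form_exists : exists phi : {symmetric V},
  const_columns phi a /\ forall j, (j <= b)%N -> const_row phi a j.
Proof.
have [phi [colP rowP _]] := moutard_form_columns (leqnn a).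
exists phi; split=> //; elim=> [|j IH] jb; first exact: rowP.
apply: (@strip_const a (y^~ j) (y^~ j.+1) (mu^~ j)) => [k ka|k ka|k l|k ka|].
- exact: mu0.
- by rewrite moutard // addrC [in RHS]addrC addrC.
- by move=> ka la; apply: IH => //; apply: ltnW.
- by apply: colP => //; apply: ltnW.
- exact: colP.
Qed.

(** [rowAll] tests a point of row 0 against the hook of the preceding column, where only the values
    on that column are not given. Pairs from the hook of column 0 then suffice. *)
Lemma moutard_form_unique (phi psi : {symmetric V}) (c : F) :
    (forall i j j', (i <= a)%N -> (j <= b)%N -> (j' <= b)%N ->
      psi (y i j) (y i j') = c * phi (y i j) (y i j')) ->
    (forall i i' j, (i <= a)%N -> (i' <= a)%N -> (j <= b)%N ->
      psi (y i j) (y i' j) = c * phi (y i j) (y i' j)) ->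
  forall u v, psi u v = c * phi u v.
Proof.
move=> colP rowP.
have WL u : linear_pred (fun v => psi u v = c * phi u v).
  split=> [|k v w vP wP]; first by rewrite !(sform0r psi, sform0r phi) mulr0.
  by rewrite !sformE vP wP; ring.
have rowAll i : (i <= a)%N -> forall v, psi (y i 0) v = c * phi (y i 0) v.
  case: i => [_|i ia].
    apply: (@hook_span _ 0) => // [l lb|k ka]; first exact: colP.
    exact: rowP.
  apply: (@hook_span _ i) => [||l lb|k ka] //; first exact: ltnW; last first.
    exact: rowP.
  (* The defect [E] vanishes at [k = l], where both points lie in row [l], and [E k.+1] is [mu i k]
     times [E k]; so it vanishes all the way down to row 0. *)
  pose E k := psi (y i.+1 k) (y i l) - c * phi (y i.+1 k) (y i l).
  suff: forall k, (k <= l)%N -> E (l - k)%N = 0.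
    by move=> /(_ l (leqnn l)); rewrite subnn => /eqP; rewrite subr_eq0 => /eqP.
  elim=> [|k IH] kl; first by rewrite subn0 /E rowP ?subrr // ltnW.
  have kb : (l - k.+1 < b)%N by lia.
  apply: (mulfI (mu0 ia kb)); rewrite mulr0 -(IH (ltnW kl)).
  have -> : (l - k)%N = (l - k.+1).+1 by lia.
  have zS : y i.+1 (l - k.+1).+1 =
      mu i (l - k.+1)%N *: (y i.+1 (l - k.+1)%N + y i (l - k.+1).+1)
      - y i (l - k.+1)%N by rewrite -moutard // addrC addKr.
  rewrite /E zS !sformE !colP ?(ltnW kb) ?(ltnW ia) //; ring.
move=> u v; rewrite (sformC psi) [phi u v]sformC; move: u; apply: (@hook_span _ 0) => //.
  move=> l lb; rewrite (sformC psi) [phi v _]sformC; move: v; apply: (@hook_span _ 0) => //.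
    by move=> l' l'b; apply: colP.
  by move=> k ka; rewrite (sformC psi) [phi _ (y k 0)]sformC; apply: rowAll.
by move=> k ka; rewrite (sformC psi) [phi v _]sformC; apply: rowAll.
Qed.

End MoutardNets.


(** * Conics *)
Section Points.
Local Open Scope ring_scope.
Local Open Scope classical_set_scope.
Variables (R : realType) (n : nat).
Local Notation V := 'rV[R]_n.+1.
Implicit Types (p : ppoint R n) (U : {vspace V}) (phi psi : {symmetric V}).
Implicit Types (r u v w e f g : V).

Lemma ppoint_gen p : exists2 r, r != 0 & pspace p = <[r]>%VS.
Proof.
case: p => U /= dU; exists (vpick U); first by rewrite vpick0 -dimv_eq0 (eqP dU).
apply/eqP; rewrite eq_sym eqEdim -memvE memv_pick (eqP dU) dim_vline vpick0.
by rewrite -dimv_eq0 (eqP dU).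
Qed.

Lemma ppoint_of r : r != 0 :> V -> exists p : ppoint R n, pspace p = <[r]>%VS.
Proof.
move=> r0; have dr : \dim <[r]> == 1%N by rewrite dim_vline r0.
by exists (PPoint dr).
Qed.

Lemma ppoint_inj p q : pspace p = pspace q -> p = q.
Proof. exact: val_inj. Qed.

Lemma vline_eq (k : R) r : k != 0 -> <[k *: r]>%VS = <[r]>%VS.
Proof.
move=> k0; apply/eqP; rewrite eqEsubv -!memvE memvZ ?memv_line //=.
by rewrite -[X in X \in _](scalerK k0) memvZ // memv_line.
Qed.

Lemma equationP U phi Q p r : equation U phi Q -> pspace p = <[r]>%VS ->
  Q p <-> r \in U /\ phi r r = 0.
Proof.
move=> [_ ->] pr /=; rewrite pr -memvE; split=> -[rU h]; split=> //.
  exact/h/memv_line.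
by move=> x /vlineP[k ->]; rewrite !sformE h !mulr0.
Qed.

Lemma form_polar U phi : (forall u, u \in U -> phi u u = 0) ->
  forall u v, u \in U -> v \in U -> phi u v = 0.
Proof.
move=> h u v uU vU; have := h _ (memvD uU vU).
rewrite !sformE !h // (sformC phi v) addr0 add0r => h2; lra.
Qed.

Lemma eq_form_on U phi psi (c : R) (e f g : V) :
    U = (<[e]> + <[f]> + <[g]>)%VS ->
    psi e e = c * phi e e -> psi f f = c * phi f f -> psi g g = c * phi g g ->
    psi e f = c * phi e f -> psi e g = c * phi e g -> psi f g = c * phi f g ->
  forall u v, u \in U -> v \in U -> psi u v = c * phi u v.
Proof.
move=> -> ee ff gg ef eg fg u v.
move=> /memv_addP[_ /memv_addP[_ /vlineP[x1 ->] [_ /vlineP[x2 ->] ->]]].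
move=> [_ /vlineP[x3 ->] ->].
move=> /memv_addP[_ /memv_addP[_ /vlineP[y1 ->] [_ /vlineP[y2 ->] ->]]].
move=> [_ /vlineP[y3 ->] ->].
rewrite !sformE !(sformC _ f e) !(sformC _ g e) !(sformC _ g f).
rewrite ee ff gg ef eg fg; ring.
Qed.

Lemma plane_coords U e f g u : U = (<[e]> + <[f]> + <[g]>)%VS -> u \in U ->
  exists x y z, u = x *: e + y *: f + z *: g.
Proof.
move=> ->.
move=> /memv_addP[_ /memv_addP[_ /vlineP[x ->] [_ /vlineP[y ->] ->]]].
by move=> [_ /vlineP[z ->] ->]; exists x, y, z.
Qed.

Definition independent3 e f g := forall x y z : R,
  x *: e + y *: f + z *: g = 0 -> [/\ x = 0, y = 0 & z = 0].

Lemma independent3P e f g :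
  \dim (<[e]> + <[f]> + <[g]>)%VS = 3%N <-> independent3 e f g.
Proof.
have -> : (<[e]> + <[f]> + <[g]>)%VS = <<[:: e; f; g]>>%VS.
  by rewrite !span_cons span_nil addv0 addvA.
have -> : (\dim <<[:: e; f; g]>>%VS = 3%N) <-> free [tuple e; f; g].
  by rewrite /free /=; split=> /eqP.
split=> [/freeP h x y z xyz|h].
  have := h (fun i => [:: x; y; z]`_i); rewrite !big_ord_recl big_ord0 /=.
  rewrite addr0 addrA => /(_ xyz) k.
  by split; [have := k 0|have := k 1|have := k 2%:R].
apply/freeP => k; rewrite !big_ord_recl big_ord0 /= addr0 addrA => /h[k0 k1 k2].
move=> i; case: i => -[|[|[|//]]] ?.
- by rewrite -[RHS]k0; congr k; apply: val_inj.
- by rewrite -[RHS]k1; congr k; apply: val_inj.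
- by rewrite -[RHS]k2; congr k; apply: val_inj.
Qed.

Lemma plane_span U e f g : \dim U = 3%N -> e \in U -> f \in U -> g \in U ->
  independent3 e f g -> U = (<[e]> + <[f]> + <[g]>)%VS.
Proof.
move=> dU eU fU gU /independent3P d3; apply/eqP.
by rewrite eq_sym eqEdim d3 dU leqnn andbT !subv_add -!memvE eU fU gU.
Qed.

(** A point [e] of the conic extends to a basis with [f] isotropic, [phi e f = 1] and [g] orthogonal
    to both. The conic is then a parametrised parabola, and a few of its points fix the other form
    up to a factor. A real point is indispensable: all definite forms have the same empty zero
    set. *)
Lemma nondegenerate_equation_unique U phi psi Q : \dim U = 3%N ->
    equation U phi Q -> (~ exists p, singular_point U phi Q p) -> Q !=set0 ->
    equation U psi Q ->
  exists2 c, c != 0 & forall u v, u \in U -> v \in U -> psi u v = c * phi u v.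
Proof.
move=> dU eqphi nsing [p Qp] eqpsi.
have Qpsi r : r != 0 -> r \in U -> phi r r = 0 -> psi r r = 0.
  move=> r0 rU rr; have [q qr] := ppoint_of r0.
  by apply: (proj1 (equationP eqpsi qr) _).2; apply/(equationP eqphi qr).
have nrad r : r != 0 -> r \in U -> exists2 u, u \in U & phi r u != 0.
  move=> r0 rU; apply: contrapT => nu; apply: nsing.
  have ru u : u \in U -> phi r u = 0.
    by move=> uU; apply/eqP; apply: contrapT => /negP h; apply: nu; exists u.
  have [q qr] := ppoint_of r0; exists q; split.
    by apply/(equationP eqphi qr); rewrite ru.
  by move=> x u; rewrite qr => /vlineP[k ->] uU; rewrite !sformE ru ?mulr0.
have [e e0 pe] := ppoint_gen p.
have [eU ee] : e \in U /\ phi e e = 0 by apply/(equationP eqphi pe).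
have [f0 f0U ef0] := nrad e e0 eU.
have [f1 f1U ef1] : exists2 f1, f1 \in U & phi e f1 = 1.
  by exists ((phi e f0)^-1 *: f0); rewrite ?memvZ // !sformE mulVf.
have [f [fU ef ff]] : exists f, [/\ f \in U, phi e f = 1 & phi f f = 0].
  exists (f1 - (phi f1 f1 / 2) *: e); split; first by rewrite memvB // memvZ.
    by rewrite !sformE ee ef1; ring.
  by rewrite !sformE ee (sformC phi f1 e) ef1; field.
have fe : phi f e = 1 by rewrite sformC.
have [g0 g0U g0ef] : exists2 g0, g0 \in U & g0 \notin (<[e]> + <[f]>)%VS.
  apply: contrapT => h.
  have sub : (U <= <[e]> + <[f]>)%VS.
    apply/subvP => u uU; apply: contrapT => /negP uef; apply: h; exists u => //.
  have := dimvS sub; rewrite dU; apply/negP; rewrite -ltnNge ltnS.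
  by apply: leq_trans (dimv_add_leqif _ _) _; rewrite !dim_vline; do 2!case: (_ != 0).
have [g [gU ge gf gef]] : exists g,
    [/\ g \in U, phi g e = 0, phi g f = 0 & g \notin (<[e]> + <[f]>)%VS].
  exists (g0 - (phi g0 f *: e + phi g0 e *: f)); split.
  - by rewrite memvB // memvD // memvZ.
  - by rewrite !sformE ee fe; ring.
  - by rewrite !sformE ff ef; ring.
  apply: contra g0ef => h; rewrite -[g0](subrK (phi g0 f *: e + phi g0 e *: f)).
  by rewrite memvD // memv_add // memvZ // memv_line.
have eg : phi e g = 0 by rewrite sformC.
have fg : phi f g = 0 by rewrite sformC.
have ind : independent3 e f g.
  move=> x y z xyz.
  have x0 : y = 0.
    by have := congr1 (phi e) xyz; rewrite !sformE ee ef eg sform0r; lra.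
  have y0 : x = 0.
    by have := congr1 (phi f) xyz; rewrite !sformE ff fe fg sform0r; lra.
  split=> //; apply: contraNeq gef => z0.
  move: xyz; rewrite x0 y0 !scale0r !add0r => /eqP.
  by rewrite scaler_eq0 (negPf z0) => /eqP->; rewrite mem0v.
have Uefg := plane_span dU eU fU gU ind.
have gg : phi g g != 0.
  have g_neq0 : g != 0 by apply: contraNneq gef => ->; rewrite mem0v.
  have [u uU] := nrad g g_neq0 gU; apply: contra_neq => gg.
  have [x [y [z ->]]] := plane_coords Uefg uU.
  by rewrite !sformE ge gf gg; ring.
set d := phi g g in gg.
have psi_ee : psi e e = 0 by apply: Qpsi.
have f_neq0 : f != 0 by apply: contra_eq_neq ef => ->; rewrite sform0r eq_sym oner_eq0.
have psi_ff : psi f f = 0 by apply: Qpsi.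
(* the isotropic vectors [- d t^2 / 2 e + f + t g] of the parabola *)
have par (t : R) : - d * t ^+ 2 * psi e f - d * t ^+ 3 * psi e g + 2 * t * psi f g
    + t ^+ 2 * psi g g = 0.
  pose r := (- (d * t ^+ 2 / 2)) *: e + f + t *: g.
  have rU : r \in U by rewrite !memvD // memvZ.
  have er : phi e r = 1 by rewrite !sformE ee ef eg; ring.
  have r0 : r != 0 by apply: contra_eq_neq er => ->; rewrite sform0r eq_sym oner_eq0.
  have := Qpsi r r0 rU; rewrite !sformE ee ff ge gf eg fg fe ef -/d => h.
  rewrite psi_ee psi_ff !(sformC psi f e) !(sformC psi g e) !(sformC psi g f) in h.
  rewrite -[RHS]h; last by field.
  by field.
(* Opposite parameters separate the even part, which gives [psi g g], from the odd part; the second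
   pair separates the cubic term from the linear one. *)
have p1 := par 1; have pm1 := par (-1); have p2 := par 2; have pm2 := par (-2).
have deg : d * psi e g = 0 by lra.
have psi_eg : psi e g = 0 by apply: (mulfI gg); rewrite mulr0.
have psi_fg : psi f g = 0 by lra.
have psi_gg : psi g g = d * psi e f by lra.
have psiE : forall u v, u \in U -> v \in U -> psi u v = psi e f * phi u v.
  apply: (eq_form_on Uefg); rewrite ?psi_ee ?psi_ff ?psi_eg ?psi_fg ?psi_gg
    ?ee ?ff ?ef ?eg ?fg -/d; ring.
exists (psi e f) => //; apply/eqP => c0.
have [[u [v [uU vU /eqP uv]]] _] := eqpsi.
by apply: uv; rewrite psiE // c0 mul0r.
Qed.

(** If some [v] in [L] were not orthogonal to some [u] outside [L], the form at [u + t v] would be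
    affine in [t] with non-zero slope and so vanish at a vector outside [L]. Hence the line lies in
    the radical of each of its equations. *)
Lemma double_line_polar U L phi : (L <= U)%VS ->
    equation U phi (points_of L) ->
  (forall v u, v \in L -> u \in U -> phi v u = 0) /\
  (forall u, u \in U -> u \notin L -> phi u u != 0).
Proof.
move=> LU eqphi.
have notL u : u \in U -> u \notin L -> phi u u != 0.
  move=> uU uL; have u0 : u != 0 by apply: contraNneq uL => ->; rewrite mem0v.
  have [p pu] := ppoint_of u0; apply: contra uL => /eqP uu.
  by have := proj2 (equationP eqphi pu) (conj uU uu); rewrite /points_of /= pu -memvE.
have inL u : u \in L -> phi u u = 0.
  have [->|u0] := eqVneq u 0; first by rewrite sform0l.
  move=> uL; have [p pu] := ppoint_of u0.
  by apply: (proj1 (equationP eqphi pu) _).2; rewrite /points_of /= pu -memvE.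
split=> // v u vL uU.
have [uL|uL] := boolP (u \in L); first exact: (form_polar inL).
have uu := notL u uU uL; apply/eqP; apply: contraT => vu.
pose t := - phi u u / (2 * phi v u).
have utU : u + t *: v \in U by rewrite memvD // memvZ // (subvP LU).
have utL : u + t *: v \notin L 
  by apply: contra uL => h; rewrite -[u](addrK (t *: v)) memvB // memvZ.
have := notL _ utU utL; rewrite !sformE (inL v vL) (sformC phi u v) /t.
by apply: contraNT => _; apply/eqP; field.
Qed.

End Points.

(** * Normal form of a conic inscribed in one face *)

Section Faces.
Local Open Scope ring_scope.
Variables (R : realType) (n : nat).
Local Notation V := 'rV[R]_n.+1.
Implicit Types (U : {vspace V}) (phi psi : {symmetric V}) (r u v w e f g : V).

(* The sign [eps] of the product of the last two normalised vertices cannot be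
   -1, since then [y * z = 0], i.e. three vertices would be collinear. *)
Lemma face_sign (x y z c eps : R) : x != 0 -> y != 0 -> z != 0 -> c != 1 ->
    eps ^+ 2 = 1 -> x + y + c * z = 1 -> x + c * y + z = eps ->
    x * (x + y + z) + y + eps * z = 1 ->
  [/\ x = -1, y = z & y * (1 + c) = 2].
Proof.
move=> x0 y0 z0 c1 /eqP; rewrite sqrf_eq1 => eps1 E1 E2 E3.
have c1' : 1 - c != 0 by rewrite subr_eq0 eq_sym.
case/orP: eps1 => /eqP eps1; rewrite eps1 in E2 E3; last first.
  (* Once [E1] and [E2] are rewritten in the difference and the sum of [y] and [z], the identity
     [4 y z = (y + z)^2 - (y - z)^2] combines them with [E3] to [y z = 0]. *)
  have d : (1 - c) * (y - z) = 2 by lra.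
  have s : (1 + c) * (y + z) = - 2 * x by lra.
  have [cm|cp] := eqVneq (1 + c) 0.
    by case/eqP: x0; rewrite cm mul0r in s; lra.
  have : (1 - c) ^+ 2 * (1 + c) * (4 * (y * z)) = 0.
    have -> : (1 - c) ^+ 2 * (1 + c) * (4 * (y * z)) =
      (1 - c) ^+ 2 * ((1 + c) * (y + z)) * (y + z)
      - (1 + c) * ((1 - c) * (y - z)) ^+ 2 by ring.
    rewrite d s.
    have E3' : x * (x + (y + z)) = 1 - (y - z) by lra.
    have E4 : (1 - c) * (x * (2 * (x + (y + z)))) = - 2 * (1 + c).
      have -> : (1 - c) * (x * (2 * (x + (y + z)))) =
        2 * ((1 - c) * (x * (x + (y + z)))) by ring.
      rewrite E3' mulrBr d; ring.
    have E5 : 2 * (x + (y + z)) = (1 - c) * (y + z).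
      have -> : 2 * (x + (y + z)) = 2 * x + 2 * (y + z) by ring.
      have -> : 2 * x = - ((1 + c) * (y + z)) by rewrite s; ring.
      ring.
    rewrite E5 in E4.
    have -> : (1 - c) ^+ 2 * (- 2 * x) * (y + z) =
      - 2 * ((1 - c) * (x * ((1 - c) * (y + z)))) by ring.
    rewrite E4; ring.
  move/eqP; rewrite !mulf_eq0 (negPf y0) (negPf z0) (negPf cp) /=.
  by rewrite (negPf c1') pnatr_eq0.
have yz : y = z.
  by apply: (mulfI c1'); lra.
rewrite -yz in E1 E2 E3 *.
(* For the sign 1, [E3] factors: the factor [x + 1] leads to the Moutard equation, and the other one
   turns [E1] into [(1 - c) y = 0]. *)
have : (x + 1) * (x - 1 + 2 * y) = 0.
  have -> : (x + 1) * (x - 1 + 2 * y) = x * (x + y + y) + y + 1 * y - 1 by ring.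
  by rewrite E3 subrr.
move/eqP; rewrite mulf_eq0 => /orP[/eqP xm1|/eqP h].
  by split=> //; lra.
case/eqP: y0; apply: (mulfI c1'); rewrite mulr0; lra.
Qed.

(* The vertices are in the order (0,0), (1,0), (0,1), (1,1). *)
Definition koenigs_face phi (A mu : R) u0 u1 u2 u3 :=
  [/\ A != 0, mu != 0, u0 + u3 = mu *: (u1 + u2),
      [/\ phi u0 u0 = A, phi u1 u1 = A & phi u2 u2 = A] &
      [/\ phi u0 u1 = A, phi u0 u2 = A & mu * (A + phi u1 u2) = 2 * A]].

Lemma koenigs_faceZ phi A mu u0 u1 u2 u3 k : k != 0 ->
  koenigs_face phi A mu u0 u1 u2 u3 ->
  koenigs_face phi (k ^+ 2 * A) mu (k *: u0) (k *: u1) (k *: u2) (k *: u3).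
Proof.
move=> k0 [A0 mu0 E [h00 h11 h22] [h01 h02 h12]]; split=> //.
- by rewrite mulf_neq0 // expf_neq0.
- by rewrite -!scalerDr E !scalerA mulrC.
- by rewrite !sformE h00 h11 h22; split; ring.
- rewrite !sformE h01 h02; split; try ring.
  have -> : mu * (k ^+ 2 * A + k * (k * phi u1 u2)) =
    k ^+ 2 * (mu * (A + phi u1 u2)) by ring.
  rewrite h12; ring.
Qed.

(** The last equation of [koenigs_face] is [phi u1 u3 = A] with [u3] eliminated by the Moutard
    equation; being symmetric in [u1] and [u2], it serves both edges at [u3]. *)
Lemma koenigs_face_last phi A mu u0 u1 u2 u3 :
    koenigs_face phi A mu u0 u1 u2 u3 ->
  [/\ phi u1 u3 = A, phi u2 u3 = A & phi u3 u3 = A].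
Proof.
move=> [A0 mu0 E [h00 h11 h22] [h01 h02 h12]].
have u3E : u3 = mu *: (u1 + u2) - u0 by rewrite -E addrC addKr.
have h13 : phi u1 u3 = A.
  by rewrite u3E !sformE h11 (sformC phi u1 u0) h01 h12; ring.
have h23 : phi u2 u3 = A.
  rewrite u3E !sformE h22 (sformC phi u2 u0) h02 (sformC phi u2 u1) addrC.
  by rewrite [X in _ * X]addrC h12; ring.
split=> //; rewrite {1}u3E !sformE h13 h23.
rewrite u3E !sformE h00 h01 h02; ring.
Qed.

Lemma tangent_det phi e f t : t != 0 -> t \in (<[e]> + <[f]>)%VS ->
    phi t e = 0 -> phi t f = 0 ->
  phi e f ^+ 2 = phi e e * phi f f.
Proof.
move=> t0 /memv_addP[_ /vlineP[x ->] [_ /vlineP[y ->] tE]].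
rewrite tE !sformE (sformC phi f e) => h1 h2; apply/eqP; rewrite -subr_eq0.
set d := _ - _.
have xd : x * d = 0.
  have -> : x * d = phi e f * (x * phi e f + y * phi f f)
    - phi f f * (x * phi e e + y * phi e f) by rewrite /d; ring.
  by rewrite h1 h2; ring.
have yd : y * d = 0.
  have -> : y * d = phi e f * (x * phi e e + y * phi e f)
    - phi e e * (x * phi e f + y * phi f f) by rewrite /d; ring.
  by rewrite h1 h2; ring.
apply: contraNT t0 => d0; rewrite tE.
move/eqP: xd; move/eqP: yd; rewrite !mulf_eq0 (negPf d0) !orbF => /eqP-> /eqP->.
by rewrite !scale0r addr0.
Qed.

Section OneFace.
Variables (U : {vspace V}) (e0 e1 e2 e3 : V).
Hypothesis dU : \dim U = 3%N.
Hypotheses (e0U : e0 \in U) (e1U : e1 \in U) (e2U : e2 \in U) (e3U : e3 \in U).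
Hypothesis ind013 : independent3 e0 e1 e3.
Hypothesis ind132 : independent3 e1 e3 e2.
Hypothesis ind320 : independent3 e3 e2 e0.
Hypothesis ind201 : independent3 e2 e0 e1.

Lemma face_basis : U = (<[e2]> + <[e0]> + <[e1]>)%VS.
Proof. exact: plane_span. Qed.

Lemma face_coords : exists x y z, [/\ x != 0, y != 0, z != 0 &
  e3 = x *: e0 + y *: e1 + z *: e2].
Proof.
have [z [x [y e3E]]] := plane_coords face_basis e3U.
have {}e3E : e3 = x *: e0 + y *: e1 + z *: e2 by rewrite e3E -addrA addrC.
have o1 := oner_neq0 R.
exists x, y, z; split=> //; apply: contra_neq o1 => h0; rewrite h0 scale0r in e3E.
- have [] := @ind132 (- y) 1 (- z) => //.
  by rewrite e3E add0r scale1r !scaleNr addKr subrr.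
- have [] := @ind320 1 (- z) (- x) => //.
  by rewrite e3E addr0 scale1r !scaleNr addrK subrr.
- have [] := @ind013 (- x) (- y) 1 => //.
  by rewrite e3E addr0 scale1r !scaleNr -opprD addNr.
Qed.

Lemma face_neq0 : [/\ e0 != 0, e1 != 0, e2 != 0 & e3 != 0].
Proof.
have o1 := oner_neq0 R.
split; apply: contra_neq o1 => h.
- by have [] := @ind013 1 0 0 => //; rewrite h !scale0r scaler0 !addr0.
- by have [] := @ind013 0 1 0 => //; rewrite h !scale0r scaler0 !addr0.
- by have [] := @ind320 0 1 0 => //; rewrite h !scale0r scaler0 !addr0.
- by have [] := @ind013 0 0 1 => //; rewrite h !scale0r scaler0 !addr0.
Qed.

(** Vanishing Gram determinants on the edges let the vertices be scaled so that all squares and the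
    products along three edges equal [A]. The fourth edge then has product [eps * A] with
    [eps ^+ 2 = 1], and [face_sign] settles both the sign and the Moutard coefficient. *)
Lemma face_nondegenerate phi :
    (forall r, r \in U -> (forall u, u \in U -> phi r u = 0) -> r = 0) ->
    phi e0 e1 ^+ 2 = phi e0 e0 * phi e1 e1 ->
    phi e0 e2 ^+ 2 = phi e0 e0 * phi e2 e2 ->
    phi e1 e3 ^+ 2 = phi e1 e1 * phi e3 e3 ->
    phi e2 e3 ^+ 2 = phi e2 e2 * phi e3 e3 ->
  exists k1 k2 k3 A mu, [/\ k1 != 0, k2 != 0, k3 != 0 &
    koenigs_face phi A mu e0 (k1 *: e1) (k2 *: e2) (k3 *: e3)].
Proof.
move=> nrad d01 d02 d13 d23.
have [x [y [z [x0 y0 z0 e3E]]]] := face_coords.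
have [n0 n1 n2 n3] := face_neq0.
have U201 := face_basis.
have U132 := plane_span dU e1U e3U e2U ind132.
have U013 := plane_span dU e0U e1U e3U ind013.
have U320 := plane_span dU e3U e2U e0U ind320.
(* An isotropic vertex would be orthogonal to both of its neighbours, hence a singular point. *)
have vertex r f g : r != 0 -> r \in U -> U = (<[f]> + <[r]> + <[g]>)%VS ->
    phi r f ^+ 2 = phi r r * phi f f -> phi r g ^+ 2 = phi r r * phi g g ->
    phi r r != 0.
  move=> r0 rU UE rf rg; apply: contra_neq r0 => rr.
  move: rf rg; rewrite rr !mul0r => /eqP; rewrite expf_eq0 => /andP[_ /eqP rf].
  move=> /eqP; rewrite expf_eq0 => /andP[_ /eqP rg].
  apply: nrad => // u uU; have [a [b [c ->]]] := plane_coords UE uU.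
  by rewrite !sformE rr rf rg !mulr0 !addr0.
have A0 : phi e0 e0 != 0 by apply: (vertex e0 e2 e1).
have A1 : phi e1 e1 != 0.
  apply: (vertex e1 e0 e3) => //.
  by rewrite (sformC phi e1) d01 mulrC.
have A2 : phi e2 e2 != 0.
  apply: (vertex e2 e3 e0) => //.
  by rewrite (sformC phi e2) d02 mulrC.
have A3 : phi e3 e3 != 0.
  apply: (vertex e3 e1 e2) => //; rewrite (sformC phi e3) ?d13 ?d23 mulrC //.
have sq (p q s : R) : p ^+ 2 = q * s -> q != 0 -> s != 0 -> p != 0.
  move=> E q0 s0; apply: contraNneq (mulf_neq0 q0 s0) => p0.
  by rewrite -E p0 expr0n.
have B01 := sq _ _ _ d01 A0 A1; have B02 := sq _ _ _ d02 A0 A2.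
have B13 := sq _ _ _ d13 A1 A3; have B23 := sq _ _ _ d23 A2 A3.
move: A0 A1 A2 A3 B01 B02 B13 B23 d01 d02 d13 d23.
set A := phi e0 e0; set C1 := phi e1 e1; set C2 := phi e2 e2.
set C3 := phi e3 e3; set B1 := phi e0 e1; set B2 := phi e0 e2.
set D1 := phi e1 e3; set D2 := phi e2 e3.
move=> A0 A1 A2 A3 B01 B02 B13 B23 d01 d02 d13 d23.
pose k1 := A / B1; pose k2 := A / B2; pose k3 := A / (k1 * D1).
have k10 : k1 != 0 by rewrite mulf_neq0 // invr_neq0.
have k20 : k2 != 0 by rewrite mulf_neq0 // invr_neq0.
have k30 : k3 != 0 by rewrite mulf_neq0 // invr_neq0 // mulf_neq0.
have k1C1 : k1 ^+ 2 * C1 = A.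
  by rewrite /k1 expr_div_n d01; field; rewrite A0 A1.
have k2C2 : k2 ^+ 2 * C2 = A.
  by rewrite /k2 expr_div_n d02; field; rewrite A0 A2.
have k3C3 : k3 ^+ 2 * C3 = A.
  rewrite /k3 expr_div_n exprMn d13 mulrA k1C1; field; by rewrite A0 A3.
have h13 : k1 * (k3 * D1) = A by rewrite /k3; field; rewrite k10 B13.
pose eps := k2 * (k3 * D2) / A.
have eps2 : eps ^+ 2 = 1.
  have -> : eps ^+ 2 = k2 ^+ 2 * (k3 ^+ 2 * D2 ^+ 2) / A ^+ 2 by rewrite /eps; field.
  rewrite d23; have -> : k2 ^+ 2 * (k3 ^+ 2 * (C2 * C3)) / A ^+ 2 =
    k2 ^+ 2 * C2 * (k3 ^+ 2 * C3) / A ^+ 2 by field.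
  by rewrite k2C2 k3C3; field.
have h23 : k2 * (k3 * D2) = eps * A by rewrite /eps; field.
pose u1 := k1 *: e1; pose u2 := k2 *: e2; pose u3 := k3 *: e3.
have p01 : phi e0 u1 = A by rewrite /u1 !sformE -/B1 /k1; field.
have p02 : phi e0 u2 = A by rewrite /u2 !sformE -/B2 /k2; field.
have p11 : phi u1 u1 = A by rewrite /u1 !sformE -/C1 -[RHS]k1C1; ring.
have p22 : phi u2 u2 = A by rewrite /u2 !sformE -/C2 -[RHS]k2C2; ring.
have p33 : phi u3 u3 = A by rewrite /u3 !sformE -/C3 -[RHS]k3C3; ring.
have p13 : phi u1 u3 = A by rewrite /u1 /u3 !sformE -/D1.
have p23 : phi u2 u3 = eps * A by rewrite /u2 /u3 !sformE -/D2.
pose c := phi u1 u2 / A.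
have p12 : phi u1 u2 = c * A by rewrite /c; field.
pose X := k3 * x; pose Y := k3 * y / k1; pose Z := k3 * z / k2.
have u3E : u3 = X *: e0 + Y *: u1 + Z *: u2.
  rewrite /u3 e3E !scalerDr /u1 /u2 !scalerA /X /Y /Z.
  by rewrite -!mulrA !mulVf // !mulr1.
have X0 : X != 0 by rewrite mulf_neq0.
have Y0 : Y != 0 by rewrite mulf_neq0 ?invr_neq0 // mulf_neq0.
have Z0 : Z != 0 by rewrite mulf_neq0 ?invr_neq0 // mulf_neq0.
have [u1E u2E u3def] : [/\ u1 = k1 *: e1, u2 = k2 *: e2 & u3 = k3 *: e3] by [].
clearbody u1 u2 u3 c eps X Y Z.
have p10 : phi u1 e0 = A by rewrite sformC.
have p20 : phi u2 e0 = A by rewrite sformC.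
have p21 : phi u2 u1 = c * A by rewrite sformC.
(* For [c = 1] the vector [e0 - u1] would be orthogonal to [e0], [u1] and [u2]. *)
have c1 : c != 1.
  apply/eqP => c1; have : e0 - u1 = 0.
    apply: nrad => [|u uU]; first by rewrite memvB // u1E memvZ.
    have [s [t [q ->]]] := plane_coords U201 uU.
    have e2u : e2 = k2^-1 *: u2 by rewrite u2E scalerA mulVf // scale1r.
    have e1u : e1 = k1^-1 *: u1 by rewrite u1E scalerA mulVf // scale1r.
    rewrite e2u e1u !sformE p01 p02 p10 p11 p12 c1 -/A; ring.
  rewrite u1E => h; have [_ /eqP] : [/\ (0 : R) = 0, (1 : R) = 0 & - k1 = 0].
    by apply: ind201; rewrite scale0r scale1r add0r scaleNr.
  by rewrite oner_eq0.
(* [E1], [E2], [E3] state the values of the form at [u1, u3], at [u2, u3] and at [u3, u3], divided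
   by [A], in the coordinates [X], [Y], [Z] of [u3]. *)
have E1 : X + Y + c * Z = 1.
  apply: (mulfI A0); rewrite mulr1 -[RHS]p13 u3E !sformE p10 p11 p12; ring.
have E2 : X + c * Y + Z = eps.
  apply: (mulfI A0); rewrite [RHS]mulrC -[RHS]p23 u3E !sformE p20 p21 p22; ring.
have E3 : X * (X + Y + Z) + Y + eps * Z = 1.
  apply: (mulfI A0); rewrite mulr1 -[RHS]p33 {1}u3E !sformE p13 p23.
  rewrite u3E !sformE p01 p02 -/A; ring.
have [X1 YZ Yc] := face_sign X0 Y0 Z0 c1 eps2 E1 E2 E3.
exists k1, k2, k3, A, Y; rewrite -u1E -u2E -u3def; split=> //; split=> //.
- by rewrite u3E X1 -YZ scaleN1r -addrA addNKr scalerDr.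
- split=> //; rewrite p12.
  have -> : Y * (A + c * A) = Y * (1 + c) * A by ring.
  by rewrite Yc.
Qed.

(** The two generators of [L] are the Laplace points. Since [L] lies in the radical, the form is a
    multiple of the square of a functional vanishing on [L]; scaling the vertices to equal values of
    this functional gives the Moutard coefficient 1. *)
Lemma face_double_line phi L x y z :
    [/\ x != 0, y != 0 & z != 0] -> e3 = x *: e0 + y *: e1 + z *: e2 ->
    L = (<[x *: e0 + y *: e1]> + <[x *: e0 + z *: e2]>)%VS ->
    equation U phi (points_of L) ->
  [/\ phi e0 e0 != 0,
      forall u, u \in U -> phi e1 u = - (x / y) * phi e0 u,
      forall u, u \in U -> phi e2 u = - (x / z) * phi e0 u &
      koenigs_face phi (phi e0 e0) 1
        e0 (- (y / x) *: e1) (- (z / x) *: e2) (- x^-1 *: e3)].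
Proof.
move=> [x0 y0 z0] e3E LE eqphi.
have LU : (L <= U)%VS by rewrite LE subv_add -!memvE !memvD // memvZ.
have [polL offL] := double_line_polar LU eqphi.
have v1 u : u \in U -> phi (x *: e0 + y *: e1) u = 0.
  by apply: polL; rewrite LE -[X in X \in _]addr0 memv_add ?mem0v ?memv_line.
have v2 u : u \in U -> phi (x *: e0 + z *: e2) u = 0.
  by apply: polL; rewrite LE -[X in X \in _]add0r memv_add ?mem0v ?memv_line.
have h1 u : u \in U -> phi e1 u = - (x / y) * phi e0 u.
  move=> /v1; rewrite !sformE => /eqP; rewrite addrC addr_eq0 => /eqP h.
  by apply: (mulfI y0); rewrite h; field.
have h2 u : u \in U -> phi e2 u = - (x / z) * phi e0 u.
  move=> /v2; rewrite !sformE => /eqP; rewrite addrC addr_eq0 => /eqP h.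
  by apply: (mulfI z0); rewrite h; field.
have A0 : phi e0 e0 != 0.
  apply: offL => //; rewrite LE; apply/negP.
  move=> /memv_addP[_ /vlineP[s ->] [_ /vlineP[t ->] h]].
  have [] := @ind201 (- (t * z)) (1 - s * x - t * x) (- (s * y)).
    apply/rowP => i; have := congr1 (fun r : V => r 0 i) h.
    by rewrite !mxE => hi; lra.
  move=> {h} tz E sy.
  have t0 : t = 0 by apply: (mulIf z0); rewrite mul0r -[LHS]opprK tz oppr0.
  have s0 : s = 0 by apply: (mulIf y0); rewrite mul0r -[LHS]opprK sy oppr0.
  by move/eqP: E; rewrite t0 s0 !mul0r !subr0 oner_eq0.
have h01 : phi e0 e1 = - (x / y) * phi e0 e0 by rewrite sformC h1.
have h02 : phi e0 e2 = - (x / z) * phi e0 e0 by rewrite sformC h2.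
split=> //; split; rewrite ?oner_neq0 //.
- rewrite scale1r e3E !scalerDr !scalerA mulNr mulVf // scaleN1r !addrA subrr add0r.
  by rewrite !mulNr ![x^-1 * _]mulrC.
- by rewrite !sformE h1 // h2 // h01 h02; split=> //; field; rewrite ?x0 ?y0 ?z0.
- by rewrite !sformE h1 // h01 h02; split=> //; field; rewrite ?x0 ?y0 ?z0.
Qed.

End OneFace.

(** At [s u + s' u'] the polar form against [u] is [(s + s') A], so the line touches only where
    [s' = - s]. As [touches] asks for some equation, its uniqueness is what allows arguing with
    [phi]. *)
Lemma touches_unit U phi Q (A : R) u u' p l :
    (forall psi, equation U psi Q ->
       exists2 c, c != 0 & forall v w, v \in U -> w \in U -> psi v w = c * phi v w) ->
    equation U phi Q -> u \in U -> u' \in U -> u != u' -> A != 0 ->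
    l = (<[u]> + <[u']>)%VS ->
    phi u u = A -> phi u u' = A -> phi u' u' = A ->
  touches U Q l p <-> pspace p = <[u - u']>%VS.
Proof.
move=> uniq eqphi uU u'U uu' A0 lE h00 h01 h11.
have h10 : phi u' u = A by rewrite sformC.
have ul : u \in l by rewrite lE -[X in X \in _]addr0 memv_add ?memv_line ?mem0v.
have u'l : u' \in l by rewrite lE -[X in X \in _]add0r memv_add ?memv_line ?mem0v.
have lU : (l <= U)%VS by rewrite lE subv_add -!memvE uU.
split=> [[Qp pl [psi eqpsi polpsi]]|pE].
  have [c c0 psiE] := uniq _ eqpsi.
  have [t t0 pt] := ppoint_gen p.
  have tl : t \in l by rewrite memvE -pt.
  have tp : t \in pspace p by rewrite pt memv_line.
  have := polpsi t u tp ul; rewrite psiE ?(subvP lU) // => /eqP.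
  rewrite mulf_eq0 (negPf c0) /= => /eqP.
  move: tl; rewrite {1}lE => /memv_addP[_ /vlineP[s ->] [_ /vlineP[s' ->] tE]].
  rewrite tE !sformE h00 h10 -mulrDl => /eqP.
  rewrite mulf_eq0 (negPf A0) orbF addrC addr_eq0 => /eqP s'E.
  have {}tE : t = s *: (u - u') by rewrite tE s'E scaleNr scalerBr.
  rewrite pt tE vline_eq //.
  by apply: contraNneq t0 => s0; rewrite tE s0 scale0r.
have iso : phi (u - u') (u - u') = 0 by rewrite !sformE h00 h01 h10 h11; ring.
split.
- by apply/(equationP eqphi pE); rewrite memvB.
- by rewrite pE -memvE memvB.
exists phi => // v w; rewrite pE => /vlineP[k ->].
rewrite lE => /memv_addP[_ /vlineP[s ->] [_ /vlineP[s' ->] ->]].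
by rewrite !sformE h00 h01 h10 h11; ring.
Qed.

End Faces.


(** * Touching conics of a net *)
Section NetFaces.
Local Open Scope ring_scope.
Local Open Scope classical_set_scope.
Variables (R : realType) (n a b : nat) (P : net R n a b).
Local Notation V := 'rV[R]_n.+1.
Implicit Types (U : {vspace V}) (phi psi : {symmetric V}).
Hypothesis ndP : nondegenerate_qnet P.

Definition point_rep (p : ppoint R n) : V := vpick p.

Lemma point_repP p : point_rep p != 0 /\ pspace p = <[point_rep p]>%VS.
Proof.
have [r r0 pr] := ppoint_gen p.
have h : point_rep p != 0 by rewrite /point_rep vpick0 pr -dimv_eq0 dim_vline r0.
split=> //; apply/eqP; rewrite eq_sym eqEdim -memvE memv_pick.
by rewrite pr !dim_vline r0 h.
Qed.

Let r i j := point_rep (P i j).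

Let rE i j : pspace (P i j) = <[r i j]>%VS.
Proof. exact: (point_repP _).2. Qed.

Let r0 i j : r i j != 0.
Proof. exact: (point_repP _).1. Qed.

Section OneFace.
Variables (i : 'I_a) (j : 'I_b).
Let U := face_plane P i j.
Let e0 := r (lo i) (lo j).
Let e1 := r (hi i) (lo j).
Let e2 := r (lo i) (hi j).
Let e3 := r (hi i) (hi j).

Let spans : [/\ \dim U = 3%N, e3 \in U, independent3 e0 e1 e3,
  independent3 e1 e3 e2 & independent3 e3 e2 e0 /\ independent3 e2 e0 e1].
Proof.
have [qP _ _ /(_ i j)[s1 s2 s3 s4]] := ndP.
move: s1 s2 s3 s4; rewrite /spans_plane !rE -/e0 -/e1 -/e2 -/e3.
move=> /independent3P s1 /independent3P s2 /independent3P s3 d4.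
have /independent3P s4 := d4.
have UE : U = (<[e2]> + <[e0]> + <[e1]>)%VS.
  by rewrite /U /face_plane !rE -/e0 -/e1 -/e2 addvC addvA.
have dU : \dim U = 3%N by rewrite UE.
split=> //; have [E dE [m0 m1 m3 m2]] := qP i j.
move: m0 m1 m2 m3; rewrite !rE -/e0 -/e1 -/e2 -/e3 -!memvE => m0 m1 m2 m3.
suff -> : U = E by [].
by apply/eqP; rewrite eqEdim dE dU leqnn andbT UE !subv_add -!memvE m0 m1 m2.
Qed.

Let e0U : e0 \in U.
Proof.
rewrite /U /face_plane !rE -[e0]addr0 memv_add ?mem0v //.
by rewrite -[X in X \in _]addr0 memv_add ?mem0v ?memv_line.
Qed.
Let e1U : e1 \in U.
Proof.
rewrite /U /face_plane !rE -[e1]addr0 memv_add ?mem0v //.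
by rewrite -[X in X \in _]add0r memv_add ?mem0v ?memv_line.
Qed.
Let e2U : e2 \in U.
Proof.
by rewrite /U /face_plane !rE -[X in X \in _]add0r memv_add ?mem0v ?memv_line.
Qed.

(** From here on non-degenerate conics and double lines are treated alike. Uniqueness of the
    equation belongs to the normal form because a quadric cutting out the conic brings an equation
    of its own. *)
Lemma inscribed_conic_normal_form c : inscribed_conic P i j c ->
  exists phi k1 k2 k3 A mu, [/\ [/\ k1 != 0, k2 != 0 & k3 != 0],
    equation U phi c,
    forall psi, equation U psi c -> exists2 k, k != 0 &
      forall u v, u \in U -> v \in U -> psi u v = k * phi u v &
    koenigs_face phi A mu e0 (k1 *: e1) (k2 *: e2) (k3 *: e3)].
Proof.
have [dU e3U ind013 ind132 [ind320 ind201]] := spans.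
move=> [[phi0 eqphi0] [[[Qn0 [phi eqphi nsing]] [t01 t23 t02 t13]]|cL]].
  have uniq psi : equation U psi c -> exists2 k, k != 0 &
      forall u v, u \in U -> v \in U -> psi u v = k * phi u v.
    exact: (nondegenerate_equation_unique dU eqphi nsing Qn0).
  have nrad s : s \in U -> (forall u, u \in U -> phi s u = 0) -> s = 0.
    move=> sU srad; apply: contrapT => /eqP s0; apply: nsing.
    have [p ps] := ppoint_of s0; exists p; split.
      by apply/(equationP eqphi ps); rewrite srad.
    by move=> x u; rewrite ps => /vlineP[k ->] uU; rewrite sformZl srad ?mulr0.
  have det l e f : (exists p, touches U c l p) -> l = (<[e]> + <[f]>)%VS ->
      e \in U -> f \in U -> phi e f ^+ 2 = phi e e * phi f f.
    move=> [p [_ pl [psi eqpsi polpsi]]] lE eU fU.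
    have [k k0 psiE] := uniq _ eqpsi; have [t t0 pt] := ppoint_gen p.
    have tl : t \in l by rewrite memvE -pt.
    have lU : (l <= U)%VS by rewrite lE subv_add -!memvE eU.
    have el : e \in l by rewrite lE -[X in X \in _]addr0 memv_add ?memv_line ?mem0v.
    have fl : f \in l by rewrite lE -[X in X \in _]add0r memv_add ?memv_line ?mem0v.
    have tp : t \in pspace p by rewrite pt memv_line.
    have zero v : v \in l -> phi t v = 0.
      move=> vl; have := polpsi t v tp vl; rewrite psiE ?(subvP lU) // => /eqP.
      by rewrite mulf_eq0 (negPf k0) => /eqP.
    by apply: (tangent_det t0); rewrite ?zero // -lE.
  have [||||k1 [k2 [k3 [A [mu [k10 k20 k30 kf]]]]]] :=
      face_nondegenerate dU e0U e1U e2U e3U ind013 ind132 ind320 ind201 nrad.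
  - by apply: (det _ _ _ t01) => //; rewrite /hedge_line !rE.
  - by apply: (det _ _ _ t02) => //; rewrite /vedge_line !rE.
  - by apply: (det _ _ _ t13) => //; rewrite /vedge_line !rE.
  - by apply: (det _ _ _ t23) => //; rewrite /hedge_line !rE.
  by exists phi, k1, k2, k3, A, mu.
have [x [y [z [x0 y0 z0 e3E]]]] :=
  face_coords dU e0U e1U e2U e3U ind013 ind132 ind320 ind201.
(* By [e3E], [x e0 + y e1 = e3 - z e2] and [x e0 + z e2 = e3 - y e1]; these are the two Laplace
   points. *)
have LE : (laplace1 P i j + laplaceN1 P i j)%VS =
    (<[x *: e0 + y *: e1]> + <[x *: e0 + z *: e2]>)%VS.
  rewrite addvC; congr (_ + _)%VS; apply/eqP; rewrite eqEsubv; apply/andP; split.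
  - apply/subvP => w; rewrite memv_cap /hedge_line !rE -/e0 -/e1 -/e2 -/e3.
    case/andP => /memv_addP[_ /vlineP[s ->] [_ /vlineP[t ->] ->]].
    move=> /memv_addP[_ /vlineP[p ->] [_ /vlineP[q ->] E]].
    have [_ sE tE] : [/\ - p - q * z = 0, s - q * x = 0 & t - q * y = 0].
      apply: ind201; apply/rowP => l; have := congr1 (fun v : V => v 0 l) E.
      by rewrite e3E !mxE => h; lra.
    apply/vlineP; exists q; rewrite scalerDr !scalerA.
    by rewrite (subr0_eq sE) (subr0_eq tE).
  - rewrite -memvE memv_cap /hedge_line !rE -/e0 -/e1 -/e2 -/e3.
    rewrite memv_add ?memvZ ?memv_line //=.
    have -> : x *: e0 + y *: e1 = (- z) *: e2 + e3.
      by rewrite e3E scaleNr [RHS]addrC addrK.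
    by rewrite memv_add ?memvZ ?memv_line.
  - apply/subvP => w; rewrite memv_cap /vedge_line !rE -/e0 -/e1 -/e2 -/e3.
    case/andP => /memv_addP[_ /vlineP[s ->] [_ /vlineP[t ->] ->]].
    move=> /memv_addP[_ /vlineP[p ->] [_ /vlineP[q ->] E]].
    have [tE sE _] : [/\ t - q * z = 0, s - q * x = 0 & - p - q * y = 0].
      apply: ind201; apply/rowP => l; have := congr1 (fun v : V => v 0 l) E.
      by rewrite e3E !mxE => h; lra.
    apply/vlineP; exists q; rewrite scalerDr !scalerA.
    by rewrite (subr0_eq sE) (subr0_eq tE).
  - rewrite -memvE memv_cap /vedge_line !rE -/e0 -/e1 -/e2 -/e3.
    rewrite memv_add ?memvZ ?memv_line //=.
    have -> : x *: e0 + z *: e2 = (- y) *: e1 + e3.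
      by rewrite e3E scaleNr [RHS]addrC [RHS]addrAC addrK.
    by rewrite memv_add ?memvZ ?memv_line.
have xyz0 : [/\ x != 0, y != 0 & z != 0] by [].
rewrite cL in eqphi0 *.
have dbl psi := @face_double_line _ _ _ _ _ _ _ e0U e1U e2U ind201 psi _ _ _ _
  xyz0 e3E LE.
have [A0 h1 h2 kf] := dbl _ eqphi0.
exists phi0, (- (y / x)), (- (z / x)), (- x^-1), (phi0 e0 e0), 1; split=> //.
  by rewrite !oppr_eq0 !mulf_neq0 ?invr_neq0.
move=> psi eqpsi; have [B0 g1 g2 _] := dbl _ eqpsi.
exists (psi e0 e0 / phi0 e0 e0); first by rewrite mulf_neq0 ?invr_neq0.
have UE := face_basis dU e0U e1U e2U ind201.
apply: (eq_form_on UE); rewrite ?g1 ?g2 ?h1 ?h2 ?(sformC _ e0 e1) ?(sformC _ e0 e2)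
  ?g1 ?g2 ?h1 ?h2 //; by field; rewrite ?A0 ?y0 ?z0.
Qed.

Definition touches_only_at c (l : {vspace V}) (w : V) :=
  forall p, touches U c l p <-> pspace p = <[w]>%VS.

(** Divided by the coefficient of its first end, each touching vector depends on a single ratio of
    scales. Such ratios can be compared between neighbouring faces, whose scales are chosen
    independently. *)
Lemma inscribed_conic_touches c : inscribed_conic P i j c ->
  exists phi k1 k2 k3 A mu, [/\ [/\ k1 != 0, k2 != 0 & k3 != 0],
    equation U phi c,
    forall psi, equation U psi c -> exists2 k, k != 0 &
      forall u v, u \in U -> v \in U -> psi u v = k * phi u v,
    koenigs_face phi A mu e0 (k1 *: e1) (k2 *: e2) (k3 *: e3) &
    [/\ touches_only_at c (hedge_line P i (lo j)) (e0 - k1 *: e1),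
        touches_only_at c (hedge_line P i (hi j)) (e2 - (k3 / k2) *: e3),
        touches_only_at c (vedge_line P (lo i) j) (e0 - k2 *: e2) &
        touches_only_at c (vedge_line P (hi i) j) (e1 - (k3 / k1) *: e3)]].
Proof.
have [dU e3U ind013 ind132 [ind320 ind201]] := spans.
move=> /inscribed_conic_normal_form.
move=> [phi [k1 [k2 [k3 [A [mu [[k10 k20 k30] eqphi uniq kf]]]]]]].
exists phi, k1, k2, k3, A, mu; split=> //.
have [A0 mu0 E [h00 h11 h22] [h01 h02 h12]] := kf.
have [h13 h23 h33] := koenigs_face_last kf.
have touch u u' k k' : k != 0 -> k' != 0 ->
    u \in U -> u' \in U -> (forall s t : R, s *: u + t *: u' = 0 -> s = 0) ->
    phi (k *: u) (k *: u) = A -> phi (k *: u) (k' *: u') = A ->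
    phi (k' *: u') (k' *: u') = A ->
    forall l, l = (<[u]> + <[u']>)%VS -> touches_only_at c l (u - (k' / k) *: u').
  move=> k0 k'0 uU u'U ind huu huu' hu'u' l lE p.
  have -> : <[u - (k' / k) *: u']>%VS = <[k *: u - k' *: u']>%VS.
    rewrite -(vline_eq (u - _) k0) scalerBr scalerA mulrCA mulfV ?mulr1 //.
  apply: (@touches_unit _ _ U phi c A (k *: u) (k' *: u') p l) => //; rewrite ?memvZ //; last first.
    by rewrite lE !vline_eq.
  apply/eqP => /eqP; rewrite -subr_eq0 -scaleNr => /eqP /ind /eqP.
  by rewrite (negPf k0).
split.
- rewrite -[k1]divr1; apply: touch => //; rewrite ?scale1r ?oner_neq0 //.
    move=> s t st; have [] := @ind013 s t 0 => //.
    by rewrite scale0r addr0.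
  by rewrite /hedge_line !rE.
- apply: touch => //; last by rewrite /hedge_line !rE.
  move=> s t st; have [//] : [/\ (0 : R) = 0, t = 0 & s = 0].
  by apply: ind132; rewrite scale0r add0r addrC.
- rewrite -[k2]divr1; apply: touch => //; rewrite ?scale1r ?oner_neq0 //.
    move=> s t st; have [//] : [/\ t = 0, s = 0 & (0 : R) = 0].
    by apply: ind201; rewrite scale0r addr0 addrC.
  by rewrite /vedge_line !rE.
- apply: touch => //; last by rewrite /vedge_line !rE.
  move=> s t st; have [] := @ind132 s t 0 => //.
  by rewrite scale0r addr0.
Qed.

End OneFace.

Lemma adjacent_face m (j : 'I_m.+1) : (0 < m)%N -> exists k : 'I_m, j = lo k \/ j = hi k.
Proof.
move=> m0; have [jm|mj] := ltnP j m.
  by exists (Ordinal jm); left; apply: val_inj.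
have jm : (j.-1 < m)%N by have := ltn_ord j; lia.
exists (Ordinal jm); right; apply: val_inj; rewrite /= /bump /=; lia.
Qed.

Lemma lo_inj m : injective (@lo m).
Proof. by move=> k k' /(congr1 val) /= kk'; apply: val_inj. Qed.

Lemma hi_inj m : injective (@hi m).
Proof. exact: lift_inj. Qed.

Lemma touching_ratio (u v : V) (h h' : R) : u != 0 -> <[u]>%VS != <[v]>%VS ->
  v != 0 -> <[u - h *: v]>%VS = <[u - h' *: v]>%VS -> h = h'.
Proof.
move=> u0 uv v0 E; have : u - h *: v \in <[u - h' *: v]>%VS by rewrite -E memv_line.
move=> /vlineP[k Ek].
have Ek' : (1 - k) *: u = (h - k * h') *: v.
  by apply/rowP => l; have := congr1 (fun w : V => w 0 l) Ek; rewrite !mxE => e; lra.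
have k1 : 1 - k = 0.
  apply: contraNeq uv => k1; have k10 : h - k * h' != 0.
    apply: contraNneq u0 => hk; move/eqP: Ek'.
    by rewrite hk scale0r scaler_eq0 (negPf k1).
  by rewrite -(vline_eq u k1) Ek' vline_eq.
move/eqP: Ek'; rewrite k1 scale0r eq_sym scaler_eq0 (negPf v0) orbF.
have -> : k = 1 by lra.
by rewrite mul1r => /eqP/subr0_eq.
Qed.

Variable C : 'I_a -> 'I_b -> set (ppoint R n).
Hypothesis touC : touching_conics P C.

Definition htouch_ratio i (j : 'I_b.+1) (h : R) := forall k : 'I_b,
  j = lo k \/ j = hi k ->
  touches_only_at i k (C i k) (hedge_line P i j) (r (lo i) j - h *: r (hi i) j).

Definition vtouch_ratio (i : 'I_a.+1) j (h : R) := forall k : 'I_a,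
  i = lo k \/ i = hi k ->
  touches_only_at k j (C k j) (vedge_line P i j) (r i (lo j) - h *: r i (hi j)).

Lemma hrep_neq i j : <[r (lo i) j]>%VS != <[r (hi i) j]>%VS.
Proof.
by have [_ h _ _] := ndP; apply/eqP => E; case: (h i j); apply: ppoint_inj; rewrite !rE.
Qed.

Lemma vrep_neq i j : <[r i (lo j)]>%VS != <[r i (hi j)]>%VS.
Proof.
by have [_ _ h _] := ndP; apply/eqP => E; case: (h i j); apply: ppoint_inj; rewrite !rE.
Qed.

Lemma touching_vec_neq0 (u v : V) (h : R) : u != 0 -> <[u]>%VS != <[v]>%VS ->
  u - h *: v != 0.
Proof.
move=> u0 uv; apply: contraNneq uv => /subr0_eq E.
by rewrite E vline_eq //; apply: contraNneq u0 => h0; rewrite E h0 scale0r.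
Qed.

Lemma htouch_ratio_ex i j : (0 < b)%N -> exists2 h, h != 0 & htouch_ratio i j h.
Proof.
move=> b0; have [inC hC _] := touC.
have face k : j = lo k \/ j = hi k -> exists2 h, h != 0 &
    touches_only_at i k (C i k) (hedge_line P i j) (r (lo i) j - h *: r (hi i) j).
  have [phi [k1 [k2 [k3 [A [mu [[k10 k20 k30] _ _ _ [t1 t2 _ _]]]]]]]] :=
    inscribed_conic_touches (inC i k).
  by case=> ->; [exists k1|exists (k3 / k2); rewrite ?mulf_neq0 ?invr_neq0].
have common k k' : j = lo k \/ j = hi k -> j = lo k' \/ j = hi k' -> exists p,
    touches (face_plane P i k) (C i k) (hedge_line P i j) p /\
    touches (face_plane P i k') (C i k') (hedge_line P i j) p.
  move=> jk jk'; have [kk'|kk'] := eqVneq k k'.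
    rewrite -kk'; have [h h0 th] := face k jk.
    have [p pE] := ppoint_of (touching_vec_neq0 h (r0 _ _) (hrep_neq i j)).
    by exists p; split; apply/th.
  case: jk jk' => -> [].
  - by move/lo_inj/eqP; rewrite (negPf kk').
  - by move=> E; have [p [p1 p2]] := hC i k' k (esym E); exists p; rewrite {2}E.
  - by move=> E; have [p [p1 p2]] := hC i k k' E; exists p; rewrite {2}E.
  - by move/hi_inj/eqP; rewrite (negPf kk').
have [k jk] := adjacent_face j b0; have [h h0 th] := face k jk.
exists h => // k' jk'; have [h' h'0 th'] := face k' jk'.
have [p [/th p1 /th' p2]] := common k k' jk jk'.
suff -> : h = h' by [].
by apply: (touching_ratio (r0 _ _) (hrep_neq i j) (r0 _ _)); rewrite -p1 -p2.
Qed.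

Lemma vtouch_ratio_ex i j : (0 < a)%N -> exists2 h, h != 0 & vtouch_ratio i j h.
Proof.
move=> a0; have [inC _ vC] := touC.
have face k : i = lo k \/ i = hi k -> exists2 h, h != 0 &
    touches_only_at k j (C k j) (vedge_line P i j) (r i (lo j) - h *: r i (hi j)).
  have [phi [k1 [k2 [k3 [A [mu [[k10 k20 k30] _ _ _ [_ _ t1 t2]]]]]]]] :=
    inscribed_conic_touches (inC k j).
  by case=> ->; [exists k2|exists (k3 / k1); rewrite ?mulf_neq0 ?invr_neq0].
have common k k' : i = lo k \/ i = hi k -> i = lo k' \/ i = hi k' -> exists p,
    touches (face_plane P k j) (C k j) (vedge_line P i j) p /\
    touches (face_plane P k' j) (C k' j) (vedge_line P i j) p.
  move=> ik ik'; have [kk'|kk'] := eqVneq k k'.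
    rewrite -kk'; have [h h0 th] := face k ik.
    have [p pE] := ppoint_of (touching_vec_neq0 h (r0 _ _) (vrep_neq i j)).
    by exists p; split; apply/th.
  case: ik ik' => -> [].
  - by move/lo_inj/eqP; rewrite (negPf kk').
  - by move=> E; have [p [p1 p2]] := vC k' k j (esym E); exists p; rewrite {2}E.
  - by move=> E; have [p [p1 p2]] := vC k k' j E; exists p; rewrite {2}E.
  - by move/hi_inj/eqP; rewrite (negPf kk').
have [k ik] := adjacent_face i a0; have [h h0 th] := face k ik.
exists h => // k' ik'; have [h' h'0 th'] := face k' ik'.
have [p [/th p1 /th' p2]] := common k k' ik ik'.
suff -> : h = h' by [].
by apply: (touching_ratio (r0 _ _) (vrep_neq i j) (r0 _ _)); rewrite -p1 -p2.
Qed.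

Lemma hpointE i j h : (0 < b)%N -> htouch_ratio i j h ->
  pspace (hpoint P C i j) = <[r (lo i) j - h *: r (hi i) j]>%VS.
Proof.
move=> b0 th; have [k jk] := adjacent_face j b0.
(* The set of touching points is non-empty, so [xget] does not fall back to its default value. *)
have hp : htouching P C i j (hpoint P C i j).
  apply: (@xgetPex _ _ [set p | htouching P C i j p]).
  have [p pE] := ppoint_of (touching_vec_neq0 h (r0 _ _) (hrep_neq i j)).
  by exists p => k' jk'; apply/th.
exact/(th k jk)/hp.
Qed.

Lemma vpointE i j h : (0 < a)%N -> vtouch_ratio i j h ->
  pspace (vpoint P C i j) = <[r i (lo j) - h *: r i (hi j)]>%VS.
Proof.
move=> a0 th; have [k ik] := adjacent_face i a0.
have hp : vtouching P C i j (vpoint P C i j).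
  apply: (@xgetPex _ _ [set p | vtouching P C i j p]).
  have [p pE] := ppoint_of (touching_vec_neq0 h (r0 _ _) (vrep_neq i j)).
  by exists p => k' ik'; apply/th.
exact/(th k ik)/hp.
Qed.

(** Both products are the scale of the vertex opposite to [(lo i, lo j)]. This closing condition
    makes the scaling of the whole net independent of the path. *)
Lemma koenigs_face_ratios (h : 'I_a -> 'I_b.+1 -> R) (v : 'I_a.+1 -> 'I_b -> R) :
    (forall i j, htouch_ratio i j (h i j)) ->
    (forall i j, vtouch_ratio i j (v i j)) ->
  forall i j, exists phi A mu, [/\ equation (face_plane P i j) phi (C i j),
    forall psi, equation (face_plane P i j) psi (C i j) -> exists2 k, k != 0 &
      forall x y, x \in face_plane P i j -> y \in face_plane P i j ->
        psi x y = k * phi x y,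
    h i (lo j) * v (hi i) j = v (lo i) j * h i (hi j) &
    koenigs_face phi A mu (r (lo i) (lo j)) (h i (lo j) *: r (hi i) (lo j))
      (v (lo i) j *: r (lo i) (hi j))
      ((h i (lo j) * v (hi i) j) *: r (hi i) (hi j))].
Proof.
move=> hP vP i j; have [inC _ _] := touC.
have [phi [k1 [k2 [k3 [A [mu [[k10 k20 k30] eqphi uniq kf [t1 t2 t3 t4]]]]]]]] :=
  inscribed_conic_touches (inC i j).
have ratio l u w (x y : R) : u != 0 -> <[u]>%VS != <[w]>%VS -> w != 0 ->
    touches_only_at i j (C i j) l (u - x *: w) ->
    touches_only_at i j (C i j) l (u - y *: w) -> x = y.
  move=> u0 uw w0 tx ty; apply: (touching_ratio u0 uw w0).
  have [p pE] := ppoint_of (touching_vec_neq0 x u0 uw).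
  by rewrite -pE; apply/ty/tx.
have E1 : h i (lo j) = k1.
  by apply: (ratio _ _ _ _ _ _ _ _ (hP i (lo j) j (or_introl erefl)) t1);
    rewrite ?r0 ?hrep_neq.
have E2 : h i (hi j) = k3 / k2.
  by apply: (ratio _ _ _ _ _ _ _ _ (hP i (hi j) j (or_intror erefl)) t2);
    rewrite ?r0 ?hrep_neq.
have E3 : v (lo i) j = k2.
  by apply: (ratio _ _ _ _ _ _ _ _ (vP (lo i) j i (or_introl erefl)) t3);
    rewrite ?r0 ?vrep_neq.
have E4 : v (hi i) j = k3 / k1.
  by apply: (ratio _ _ _ _ _ _ _ _ (vP (hi i) j i (or_intror erefl)) t4);
    rewrite ?r0 ?vrep_neq.
have E34 : k1 * (k3 / k1) = k3 by rewrite mulrCA mulfV // mulr1.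
by exists phi, A, mu; rewrite E1 E2 E3 E4 E34 mulrCA mulfV // mulr1.
Qed.

End NetFaces.

(** * Scaling the whole net to a Moutard net *)

Section Lift.
Local Open Scope ring_scope.
Local Open Scope classical_set_scope.
Variables (R : realType) (n a' b' : nat).
Let a := a'.+1.
Let b := b'.+1.
Variable (P : net R n a b).
Local Notation V := 'rV[R]_n.+1.
Implicit Types (U : {vspace V}) (phi psi : {symmetric V}).
Hypothesis ndP : nondegenerate_qnet P.
Variable C : 'I_a -> 'I_b -> set (ppoint R n).
Hypothesis touC : touching_conics P C.

Lemma lo_inord m k : (k < m.+1)%N -> lo (inord k : 'I_m.+1) = inord k.
Proof. by move=> km; apply: val_inj; rewrite /= !inordK // ltnW. Qed.

Lemma hi_inord m k : (k < m.+1)%N -> hi (inord k : 'I_m.+1) = inord k.+1.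
Proof. by move=> km; apply: val_inj; rewrite /= /bump /= !inordK // ltnS. Qed.

Definition face i j : {vspace V} := face_plane P (inord i) (inord j).

Definition conic i j : set (ppoint R n) := C (inord i) (inord j).

(** Natural indices suit the inductions along rows and columns. The scalar [A] may differ from face
    to face, since each conic comes with its own equation. *)
Definition koenigs_lift (y : nat -> nat -> V) (mu : nat -> nat -> R) :=
  [/\ forall i j, (i <= a)%N -> (j <= b)%N ->
        pspace (P (inord i) (inord j)) = <[y i j]>%VS,
      forall i j, (i < a)%N -> (j <= b)%N ->
        pspace (hpoint P C (inord i) (inord j)) = <[y i j - y i.+1 j]>%VS,
      forall i j, (i <= a)%N -> (j < b)%N ->
        pspace (vpoint P C (inord i) (inord j)) = <[y i j - y i j.+1]>%VS &
      forall i j, (i < a)%N -> (j < b)%N -> exists phi A,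
        [/\ equation (face i j) phi (conic i j),
            forall psi, equation (face i j) psi (conic i j) ->
              exists2 k, k != 0 & forall u v, u \in face i j ->
                v \in face i j -> psi u v = k * phi u v &
            koenigs_face phi A (mu i j) (y i j) (y i.+1 j) (y i j.+1)
              (y i.+1 j.+1)]].

(** The scale [g i j] is the product of the touching ratios along row 0 and then up column [i]. By
    construction it fits the vertical edges; the closing condition [hv] carries the fit on
    horizontal edges from row 0 to all rows. *)
Lemma koenigs_lift_exists : exists y mu, koenigs_lift y mu.
Proof.
have /choice[hh hhP] : forall ij : 'I_a * 'I_b.+1, exists h,
    h != 0 /\ htouch_ratio P C ij.1 ij.2 h.
  by move=> ij; have [h h0 hP] := htouch_ratio_ex ndP touC ij.1 ij.2 (ltn0Sn b'); exists h.
have /choice[vv vvP] : forall ij : 'I_a.+1 * 'I_b, exists h,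
    h != 0 /\ vtouch_ratio P C ij.1 ij.2 h.
  by move=> ij; have [h h0 hP] := vtouch_ratio_ex ndP touC ij.1 ij.2 (ltn0Sn a'); exists h.
have hP i j : htouch_ratio P C i j (hh (i, j)) by exact: (hhP (i, j)).2.
have vP i j : vtouch_ratio P C i j (vv (i, j)) by exact: (vvP (i, j)).2.
have faceP := @koenigs_face_ratios _ _ _ _ _ ndP _ touC _ _ hP vP.
pose h i j := hh (inord i, inord j); pose v i j := vv (inord i, inord j).
have h0 i j : h i j != 0 by exact: (hhP _).1.
have v0 i j : v i j != 0 by exact: (vvP _).1.
have hv i j : (i < a)%N -> (j < b)%N -> h i j * v i.+1 j = v i j * h i j.+1.
  move=> ia jb; have [_ [_ [_ [_ _ + _]]]] := faceP (inord i) (inord j).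
  by rewrite !lo_inord // !hi_inord.
pose g i j := \prod_(k < i) h k 0%N * \prod_(l < j) v i l.
have g0 i j : g i j != 0.
  by rewrite mulf_neq0 //; apply/prodf_neq0.
have gv i j : g i j.+1 = g i j * v i j by rewrite /g big_ord_recr /= mulrA.
have gh i j : (i < a)%N -> (j <= b)%N -> g i.+1 j = g i j * h i j.
  move=> ia; elim: j => [|j IH] jb; first by rewrite /g !big_ord0 !mulr1 big_ord_recr.
  by rewrite !gv IH ?(ltnW jb) // -!mulrA hv.
pose r (i j : nat) : V := point_rep (P (inord i) (inord j)).
pose y i j := g i j *: r i j.
have rE i j : pspace (P (inord i) (inord j)) = <[r i j]>%VS by exact: (point_repP _).2.
have /choice[mus musP] : forall ij : nat * nat, exists mu, (ij.1 < a)%N ->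
    (ij.2 < b)%N -> exists phi A, [/\
      equation (face ij.1 ij.2) phi (conic ij.1 ij.2),
      forall psi, equation (face ij.1 ij.2) psi (conic ij.1 ij.2) ->
        exists2 k, k != 0 & forall u v, u \in face ij.1 ij.2 ->
          v \in face ij.1 ij.2 -> psi u v = k * phi u v &
      koenigs_face phi A mu (y ij.1 ij.2) (y ij.1.+1 ij.2) (y ij.1 ij.2.+1)
        (y ij.1.+1 ij.2.+1)].
  move=> [i j] /=; have [phi [A [mu [eqphi uniq _ kf]]]] := faceP (inord i) (inord j).
  exists mu => ia jb; exists phi, (g i j ^+ 2 * A); split=> //.
  have := koenigs_faceZ (g0 i j) kf; rewrite !scalerA.
  rewrite !lo_inord // !hi_inord // -/(h i j) -/(v i j) -/(v i.+1 j) mulrA.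
  by rewrite -gh ?(ltnW jb) // -!gv.
exists y, (fun i j => mus (i, j)); split=> [i j ia jb|i j ia jb|i j ia jb|i j ia jb].
- by rewrite vline_eq.
- rewrite (hpointE ndP (ltn0Sn b') (hP _ _)) lo_inord // hi_inord //.
  rewrite -(vline_eq _ (g0 i j)) scalerBr scalerA.
  by rewrite -[hh _]/(h i j) -gh.
- rewrite (vpointE ndP (ltn0Sn a') (vP _ _)) lo_inord // hi_inord //.
  rewrite -(vline_eq _ (g0 i j)) scalerBr scalerA.
  by rewrite -[vv _]/(v i j) -gv.
- exact: (musP (i, j)).
Qed.

End Lift.

(** * The inscribed quadric *)

Section InscribedQuadric.
Local Open Scope ring_scope.
Local Open Scope classical_set_scope.
Variables (R : realType) (a' b' : nat).
Let a := a'.+1.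
Let b := b'.+1.
Variable (P : net R (a + b) a b).
Local Notation V := 'rV[R]_(a + b).+1.
Implicit Types (U : {vspace V}) (phi psi : {symmetric V}).
Hypothesis extP : extensive P.
Variable C : 'I_a -> 'I_b -> set (ppoint R (a + b)).
Variables (y : nat -> nat -> V) (mu : nat -> nat -> R).
Hypothesis yP : koenigs_lift P C y mu.

Lemma lift_mu_neq0 i j : (i < a)%N -> (j < b)%N -> mu i j != 0.
Proof.
by move=> ia jb; have [_ _ _ h] := yP; have [phi [A [_ _ []]]] := h i j ia jb.
Qed.

Lemma lift_moutard i j : (i < a)%N -> (j < b)%N ->
  y i j + y i.+1 j.+1 = mu i j *: (y i.+1 j + y i j.+1).
Proof.
by move=> ia jb; have [_ _ _ h] := yP; have [phi [A [_ _ []]]] := h i j ia jb.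
Qed.

Lemma lift_dim : \dim {:V} = (a + b).+1.
Proof. by rewrite dimvf /dim /= mul1n. Qed.

Lemma lift_point (i : 'I_a.+1) (j : 'I_b.+1) : pspace (P i j) = <[y i j]>%VS.
Proof.
have [yE _ _ _] := yP.
by rewrite -(yE i j (leq_ord i) (leq_ord j)) !inord_val.
Qed.

(** Extensivity enters here: the join of the points has the dimension of the whole space. *)
Lemma lift_span W : linear_pred W ->
  (forall i j, (i <= a)%N -> (j <= b)%N -> W (y i j)) -> forall v : V, W v.
Proof.
move=> WL Wy v; have [yE _ _ _] := yP; have [_ dimP] := extP.
have : v \in (\sum_(i < a.+1) \sum_(j < b.+1) pspace (P i j))%VS.
  suff -> : (\sum_(i < a.+1) \sum_(j < b.+1) pspace (P i j))%VS = fullv by rewrite memvf.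
  by apply/eqP; rewrite eqEdim subvf dimP lift_dim leqnn.
apply: linear_pred_span => // i; apply: linear_pred_span => // j u.
rewrite lift_point => /vlineP[k ->].
by apply: linear_predZ => //; apply: Wy; apply: leq_ord.
Qed.

Lemma face_lift i j : (i < a)%N -> (j < b)%N ->
  face P i j = (<[y i j]> + <[y i.+1 j]> + <[y i j.+1]>)%VS.
Proof.
move=> ia jb; have [yE _ _ _] := yP.
by rewrite /face /face_plane !lo_inord // !hi_inord // !yE // ltnW.
Qed.

Lemma face_lift_mem i j : (i < a)%N -> (j < b)%N -> [/\ y i j \in face P i j,
  y i.+1 j \in face P i j, y i j.+1 \in face P i j & y i.+1 j.+1 \in face P i j].
Proof.
move=> ia jb; have E := face_lift ia jb.
have m0 : y i j \in face P i j.
  rewrite E -[X in X \in _]addr0 memv_add ?mem0v //.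
  by rewrite -[X in X \in _]addr0 memv_add ?mem0v ?memv_line.
have m1 : y i.+1 j \in face P i j.
  rewrite E -[X in X \in _]addr0 memv_add ?mem0v //.
  by rewrite -[X in X \in _]add0r memv_add ?mem0v ?memv_line.
have m2 : y i j.+1 \in face P i j.
  by rewrite E -[X in X \in _]add0r memv_add ?mem0v ?memv_line.
split=> //; have -> : y i.+1 j.+1 = mu i j *: (y i.+1 j + y i j.+1) - y i j.
  by rewrite -lift_moutard // addrC addKr.
by rewrite memvB // memvZ // memvD.
Qed.

(** The difference telescopes into touching vectors of consecutive edges, so the join controls
    distant pairs in a row as well as neighbours. *)
Lemma hjoin_lift j i i' : (j <= b)%N -> (i <= i')%N -> (i' <= a)%N ->
  y i j - y i' j \in hjoin P C (inord j).
Proof.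
move=> jb; have [_ hE _ _] := yP; elim: i' => [|i' IH].
  by rewrite leqn0 => /eqP->; rewrite subrr mem0v.
rewrite leq_eqVlt => /orP[/eqP->|ii'] i'a; first by rewrite subrr mem0v.
rewrite -[y i j](subrK (y i' j)) -addrA memvD //; first exact/IH/ltnW.
apply: (subvP (sumv_sup (inord i' : 'I_a) _ _)) => //.
by rewrite hE // memv_line.
Qed.

Lemma vjoin_lift i j j' : (i <= a)%N -> (j <= j')%N -> (j' <= b)%N ->
  y i j - y i j' \in vjoin P C (inord i).
Proof.
move=> ia; have [_ _ vE _] := yP; elim: j' => [|j' IH].
  by rewrite leqn0 => /eqP->; rewrite subrr mem0v.
rewrite leq_eqVlt => /orP[/eqP->|jj'] j'b; first by rewrite subrr mem0v.
rewrite -[y i j](subrK (y i j')) -addrA memvD //; first exact/IH/ltnW.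
apply: (subvP (sumv_sup (inord j' : 'I_b) _ _)) => //.
by rewrite vE // memv_line.
Qed.

Definition unit_form phi :=
  (forall i j j', (i <= a)%N -> (j <= b)%N -> (j' <= b)%N ->
     phi (y i j) (y i j') = 1) /\
  (forall i i' j, (i <= a)%N -> (i' <= a)%N -> (j <= b)%N ->
     phi (y i j) (y i' j) = 1).

Lemma unit_form_ex : exists phi, unit_form phi.
Proof.
have [phi [colP rowP]] := moutard_form_exists lift_mu_neq0 lift_moutard lift_dim lift_span.
by exists phi; split=> [i j j' ia jb j'b|i i' j ia i'a jb]; [apply: colP|apply: rowP].
Qed.

Lemma isotropic_sum phi m (U : 'I_m -> {vspace V}) (d : 'I_m -> V) :
    (forall k, U k = <[d k]>%VS) -> (forall k l, phi (d k) (d l) = 0) ->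
  forall u, u \in (\sum_k U k)%VS -> phi u u = 0.
Proof.
move=> UE dd u uU.
suff: forall v, v \in (\sum_k U k)%VS -> phi u v = 0 by apply.
have linr w : linear_pred (fun v => phi w v = 0).
  by split=> [|k v v' h h']; rewrite ?sform0r // !sformE h h' mulr0 addr0.
apply: (linear_pred_span (linr u)) => k v; rewrite UE => /vlineP[t ->].
rewrite sformZr; suff -> : phi u (d k) = 0 by rewrite mulr0.
rewrite sformC; move: uU; apply: (linear_pred_span (linr (d k))) => l w.
by rewrite UE => /vlineP[s ->]; rewrite sformZr dd mulr0.
Qed.

Definition zero_set phi : set (ppoint R (a + b)) :=
  [set p : ppoint R (a + b) | (p <= fullv)%VS /\ forall x, x \in pspace p -> phi x x = 0].

Lemma zero_set_equation phi : unit_form phi -> equation fullv phi (zero_set phi).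
Proof.
move=> [h _]; split=> //; exists (y 0 0), (y 0 0).
by rewrite !memvf h // oner_neq0.
Qed.

(** Only the value on the diagonal pair [y i.+1 j], [y i j.+1] is not given directly. The Moutard
    equation derives it from the value 1 on an edge in column [i + 1], just as in [koenigs_face]. *)
Lemma unit_form_face phi psi A i j : (i < a)%N -> (j < b)%N -> unit_form phi ->
    koenigs_face psi A (mu i j) (y i j) (y i.+1 j) (y i j.+1) (y i.+1 j.+1) ->
  forall u v, u \in face P i j -> v \in face P i j -> psi u v = A * phi u v.
Proof.
move=> ia jb [colP rowP] [A0 mu0 E [h00 h11 h22] [h01 h02 h12]].
have ia' := ltnW ia; have jb' := ltnW jb.
apply: (eq_form_on (face_lift ia jb)); rewrite ?rowP ?colP ?mulr1 //.
have zE : y i.+1 j.+1 = mu i j *: (y i.+1 j + y i j.+1) - y i j.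
  by rewrite -lift_moutard // addrC addKr.
have := colP i.+1 j j.+1 ia jb' jb.
rewrite zE !sformE (rowP i.+1 i.+1) // (rowP i.+1 i) // => e12.
apply: (mulfI mu0); apply: (addrI (mu i j * A)); rewrite -mulrDr h12.
have -> : mu i j * A + mu i j * (A * phi (y i.+1 j) (y i j.+1)) =
  A * (mu i j * (1 + phi (y i.+1 j) (y i j.+1)) - 1) + A by ring.
rewrite e12; ring.
Qed.

Lemma unit_form_inscribed phi : unit_form phi -> inscribed_quadric P C (zero_set phi).
Proof.
move=> uphi; have [colP rowP] := uphi; have [yE hE vE fE] := yP; split.
- by exists phi; apply: zero_set_equation.
- move=> i j; have ia := ltn_ord i; have jb := ltn_ord j.
  have [psi [A [eqpsi _ kf]]] := fE i j ia jb.
  have psiE := unit_form_face ia jb uphi kf; have [A0 _ _ _ _] := kf.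
  move: eqpsi psiE; rewrite /conic /face !inord_val => -[_ ->] psiE.
  apply/seteqP; split=> p /=.
    move=> [[_ h] pU]; split=> // x xp.
    by rewrite psiE ?h ?mulr0 // (subvP pU).
  move=> [pU h]; split=> //; split=> [|x xp]; first exact: subvf.
  by apply: (mulfI A0); rewrite -psiE ?h ?mulr0 // (subvP pU).
- move=> i p pv; split=> [|x xp]; first exact: subvf.
  apply: (@isotropic_sum _ _ _ (fun j : 'I_b => y i j - y i j.+1)); last first.
  + exact: (subvP pv).
  + move=> k l; have ia : (i <= a)%N by rewrite -ltnS.
    by rewrite !sformE !colP ?(ltn_ord k) ?(ltn_ord l) ?(ltnW (ltn_ord k))
      ?(ltnW (ltn_ord l)) //; ring.
  + by move=> k; rewrite -[i]inord_val -[k]inord_val vE ?inord_val // leq_ord.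
- move=> j p ph; split=> [|x xp]; first exact: subvf.
  apply: (@isotropic_sum _ _ _ (fun i : 'I_a => y i j - y i.+1 j)); last first.
  + exact: (subvP ph).
  + move=> k l; have jb : (j <= b)%N by rewrite -ltnS.
    by rewrite !sformE !rowP ?(ltn_ord k) ?(ltn_ord l) ?(ltnW (ltn_ord k))
      ?(ltnW (ltn_ord l)) //; ring.
  + by move=> k; rewrite -[j]inord_val -[k]inord_val hE ?inord_val // leq_ord.
Qed.

Lemma equation_isotropic U phi Q (L : {vspace V}) : equation U phi Q ->
  points_of L `<=` Q -> forall x, x \in L -> phi x x = 0.
Proof.
move=> eqphi LQ x xL; have [->|x0] := eqVneq x 0; first by rewrite sform0l.
have [p pE] := ppoint_of x0.
by apply: (proj1 (equationP eqphi pE) _).2; apply: LQ; rewrite /points_of /= pE -memvE.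
Qed.

(** If [phi] vanished on [U], all points of [U] would belong to [c], and then its equation [psi]
    would vanish on [U] too. *)
Lemma restrict_equation U phi psi Q c : equation fullv phi Q -> equation U psi c ->
  Q `&` points_of U = c -> equation U phi c.
Proof.
move=> [_ QE] eqpsi cE; have cE' : c = [set p : ppoint R (a + b) |
    (p <= U)%VS /\ forall x, x \in pspace p -> phi x x = 0].
  rewrite -cE QE; apply/seteqP; split=> p /= [].
    by move=> [_ h] pU.
  by move=> pU h; split=> //; split=> //; apply: subvf.
split=> //; apply: contrapT => nz.
have phi0 u v : u \in U -> v \in U -> phi u v = 0.
  by move=> uU vU; apply/eqP; apply: contrapT => /negP h; apply: nz; exists u, v.
have [[u [v [uU vU /eqP uv]]] _] := eqpsi; apply: uv.
apply: form_polar uU vU; apply: (equation_isotropic eqpsi).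
by rewrite cE' => p pU; split=> // x xp; rewrite phi0 // (subvP pU).
Qed.

(** On each face the form is a multiple of that of the conic, so its squares at the four vertices
    agree; shared vertices make the value [k] global. Two vectors with square [k] and isotropic
    difference have product [k], and differences within a row or column lie in the joins. *)
Lemma inscribed_const phi Q : equation fullv phi Q -> inscribed_quadric P C Q ->
  exists2 k, k != 0 &
  (forall i j j', (i <= a)%N -> (j <= b)%N -> (j' <= b)%N ->
     phi (y i j) (y i j') = k) /\
  (forall i i' j, (i <= a)%N -> (i' <= a)%N -> (j <= b)%N ->
     phi (y i j) (y i' j) = k).
Proof.
move=> eqphi [_ QC Qv Qh]; have [_ _ _ fE] := yP.
have faceP i j : (i < a)%N -> (j < b)%N -> exists2 k, k != 0 &
    [/\ phi (y i j) (y i j) = k, phi (y i.+1 j) (y i.+1 j) = k,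
        phi (y i j.+1) (y i j.+1) = k & phi (y i.+1 j.+1) (y i.+1 j.+1) = k].
  move=> ia jb; have [psi [A [eqpsi uniq kf]]] := fE i j ia jb.
  have [k k0 phiE] := uniq phi (restrict_equation eqphi eqpsi (QC _ _)).
  have [m0 m1 m2 m3] := face_lift_mem ia jb.
  have [A0 _ _ [h0 h1 h2] _] := kf; have [_ _ h3] := koenigs_face_last kf.
  exists (k * A); first exact: mulf_neq0.
  by split; rewrite phiE // ?h0 ?h1 ?h2 ?h3.
have [k k0 [k00 _ _ _]] := faceP 0 0 (ltn0Sn _) (ltn0Sn _).
have col i : (i <= a)%N -> phi (y i 0) (y i 0) = k.
  elim: i => [//|i IH] ia.
  have [k' _ [k1 k2 _ _]] := faceP i 0 ia (ltn0Sn _).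
  by rewrite k2 -k1 IH // ltnW.
have all i j : (i <= a)%N -> (j <= b)%N -> phi (y i j) (y i j) = k.
  move=> ia; elim: j => [|j IH] jb; first exact: col.
  case: i ia {col} IH => [|i] ia IH.
    have [k' _ [k1 _ k2 _]] := faceP 0 j (ltn0Sn _) jb.
    by rewrite k2 -k1 IH // ltnW.
  have [k' _ [_ k1 _ k2]] := faceP i j ia jb.
  by rewrite k2 -k1 IH // ltnW.
have iso u v : phi u u = k -> phi v v = k -> phi (u - v) (u - v) = 0 -> phi u v = k.
  by move=> uu vv; rewrite !sformE uu vv (sformC phi v u) => h; lra.
exists k => //; split=> [i j j' ia jb j'b|i i' j ia i'a jb].
  wlog jj' : j j' jb j'b / (j <= j')%N.
    by move=> W; case/orP: (leq_total j j') => h; [|rewrite sformC]; apply: W.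
  apply: iso; rewrite ?all //; apply: (equation_isotropic eqphi (Qv (inord i))).
  exact: vjoin_lift.
wlog ii' : i i' ia i'a / (i <= i')%N.
  by move=> W; case/orP: (leq_total i i') => h; [|rewrite sformC]; apply: W.
apply: iso; rewrite ?all //; apply: (equation_isotropic eqphi (Qh (inord j))).
exact: hjoin_lift.
Qed.

Lemma inscribed_quadric_unique phi Q : unit_form phi -> inscribed_quadric P C Q ->
  zero_set phi = Q.
Proof.
move=> [colP rowP] inQ; have [[psi eqpsi] _ _ _] := inQ.
have [k k0 [kcol krow]] := inscribed_const eqpsi inQ.
have psiE u v : psi u v = k * phi u v.
  apply: (moutard_form_unique lift_mu_neq0 lift_moutard lift_dim lift_span).
    by move=> i j j' ia jb j'b; rewrite kcol // colP // mulr1.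
  by move=> i i' j ia i'a jb; rewrite krow // rowP // mulr1.
have [_ ->] := eqpsi; apply/seteqP; split=> p /= [pf h]; split=> // x xp.
  by rewrite psiE h ?mulr0.
by apply: (mulfI k0); rewrite -psiE h ?mulr0.
Qed.

End InscribedQuadric.

Theorem theorem3p10 (R : realType) (a b : nat) (a_ge1 : (1 <= a)%N)
    (b_ge1 : (1 <= b)%N) (P : net R (a + b) a b)
    (extP : extensive P) (koeP : koenigs_net P)
    (C : 'I_a -> 'I_b -> set (ppoint R (a + b)))
    (touC : touching_conics P C) :
  exists! Q : set (ppoint R (a + b)), inscribed_quadric P C Q.
Proof.
case: a b a_ge1 b_ge1 P extP koeP C touC => [//|a] [//|b] _ _ P extP [ndP _] C touC.
have [y [mu yP]] := koenigs_lift_exists ndP touC.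
have [phi uphi] := unit_form_ex extP yP.
exists (zero_set phi); split; first exact: (unit_form_inscribed yP uphi).
by move=> Q; apply: (inscribed_quadric_unique extP yP uphi).
Qed.
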